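(* Let $(R,\mathfrak{m})$ be an $F$-finite, $F$-split (equivalently, $F$-pure) generalized Cohen-Macaulay local ring of prime characteristic $p>0$, and let $F_*(R)=R\oplus M$. (i) If $R/\mathfrak{m}$ is perfect, then $M$ is a maximal Cohen-Macaulay $R$-module. (ii) If $R/\mathfrak{m}$ is imperfect but $R$ has a coefficient field (e.g. if $R$ is complete), then $R$ admits a maximal Cohen-Macaulay $R$-module (which is possibly not $M$).
   Context: All rings are commutative with identity and Noetherian. For a ring $R$ of characteristic $p$, $F_*(R)$ is the abelian group $R$ with $R$-action $r\cdot a=r^{p}a$. $R$ is $F$-finite if $F_*(R)$ is a finitely generated $R$-module; $R$ is $F$-split if the Frobenius map $R\to F_*(R)$ is a split monomorphism of $R$-modules, and then $F_*(R)=R\oplus M$ denotes such a splitting, $M$ being a complement of $R$; $R$ is $F$-pure if $R\to F_*(R)$ is a pure map. $R$ is generalized Cohen-Macaulay if the local cohomology module $H^i_{\mathfrak m}(R)$ has finite length for all $i<\dim R$. A non-zero finitely generated $R$-module $N$ is maximal Cohen-Macaulay if $H^i_{\mathfrak m}(N)=0$ for all $i<\dim R$. A coefficient field of $(R,\mathfrak m)$ is a subfield of $R$ mapping isomorphically onto $R/\mathfrak m$.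
   Formalization: In (i) R is additionally assumed not to be a field: if R is a perfect field then F_*(R)=R and M=0, which is not maximal Cohen-Macaulay (non-zero by definition). The remarks ''equivalently, F-pure'' and ''e.g. if R is complete'' are not formalized. *)

(* Defs.v *)
From HB Require Import structures.
From mathcomp Require Import all_boot all_order all_algebra.
From mathcomp Require Import boolp classical_sets functions.

Set Implicit Arguments.
Unset Strict Implicit.
Unset Printing Implicit Defensive.

Import GRing.Theory.
Local Open Scope ring_scope.
Local Open Scope classical_set_scope.

(* MathComp's closedness predicates ([submod_closed], [idealr_closed], ...)
   are about boolean predicates. Submodules, and ideals (the submodules of
   the regular module R^o), are arbitrary subsets here. *)
Section Modules.
Variable R : comNzRingType.
Implicit Types V : lmodType R.

Definition submodule V (A : set V) : Prop :=
  A 0 /\ forall (a : R) (u v : V), A u -> A v -> A (a *: u + v).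

Definition span V n (v : 'I_n -> V) : set V :=
  [set x | exists c : 'I_n -> R, x = \sum_(i < n) c i *: v i].

Definition fg_module V : Prop :=
  exists n (v : 'I_n -> V), span v = setT.

Definition simple_step V (A B : set V) : Prop :=
  [/\ A `<=` B, A <> B &
      forall C : set V, submodule C -> A `<=` C -> C `<=` B -> C = A \/ C = B].

(* For submodules B `<=` Z of V: the subquotient Z/B has finite length, that
   is, it has a composition series; submodules of Z/B are written as
   submodules of V lying between B and Z. *)
Definition finite_length_subquotient V (Z B : set V) : Prop :=
  exists (l : nat) (C : nat -> set V),
    [/\ C 0%N = B, C l = Z, forall j, (j <= l)%N -> submodule (C j) &
        forall j, (j < l)%N -> simple_step (C j) (C j.+1)].

Definition injective_module (E : lmodType R) : Prop :=
  forall (A B : lmodType R) (i : {linear A -> B}) (f : {linear A -> E}),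
    injective i -> exists g : {linear B -> E}, forall x, g (i x) = f x.

Record injective_resolution (N : lmodType R) := InjectiveResolution {
  res_obj : nat -> lmodType R;
  res_aug : {linear N -> res_obj 0};
  res_diff : forall n, {linear res_obj n -> res_obj n.+1};
  res_injective : forall n, injective_module (res_obj n);
  res_aug_inj : injective res_aug;
  res_exact0 : forall x, res_diff 0 x = 0 <-> exists y, res_aug y = x;
  res_exactS : forall n x,
    res_diff n.+1 x = 0 <-> exists y, res_diff n y = x
}.

End Modules.

Section Ideals.
Variable R : comNzRingType.

Definition ideal (I : set R) : Prop := @submodule R R^o I.

Definition noetherian : Prop :=
  forall I : set R, ideal I ->
    exists n (x : 'I_n -> R), I = @span R R^o n x.

Definition prime_ideal (P : set R) : Prop :=
  [/\ ideal P, ~ P 1 & forall a b, P (a * b) -> P a \/ P b].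

Definition maximal_ideal (m : set R) : Prop :=
  [/\ ideal m, ~ m 1 &
      forall J : set R, ideal J -> ~ J 1 -> m `<=` J -> J = m].

Definition local_ring (m : set R) : Prop :=
  maximal_ideal m /\ forall m' : set R, maximal_ideal m' -> m' = m.

(* Used to exclude R a field from the claim on complements: for R a perfect
   field, F_*(R) = R and the only complement is 0, which is not maximal
   Cohen-Macaulay. *)
Definition is_field : Prop := forall x : R, x <> 0 -> exists y, x * y = 1.

(* P 0 `<` P 1 `<` ... `<` P l *)
Definition prime_chain (l : nat) (P : nat -> set R) : Prop :=
  (forall j, (j <= l)%N -> prime_ideal (P j)) /\
  (forall j, (j < l)%N -> P j `<` P j.+1).

(* i < dim R, where dim R is the supremum, possibly infinite, of the lengths
   of the chains of prime ideals. *)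
Definition lt_krull_dim (i : nat) : Prop :=
  exists l P, (i < l)%N /\ prime_chain l P.

Definition ideal_mul (I J : set R) : set R :=
  [set x | exists n (a b : 'I_n -> R),
     [/\ forall i, I (a i), forall i, J (b i) & x = \sum_(i < n) a i * b i]].

Fixpoint ideal_pow (I : set R) (n : nat) : set R :=
  if n is n'.+1 then ideal_mul I (ideal_pow I n') else setT.

End Ideals.

(* H^i_m(N) is the i-th right derived functor of the m-torsion functor
   Gamma_m: the subquotient lc_cocycles/lc_coboundaries of the i-th term of an
   injective resolution of N. Resolutions exist and H^i_m(N) does not depend on
   them up to isomorphism; a property of H^i_m(N) is required for all of them. *)
Section LocalCohomology.
Variables (R : comNzRingType) (m : set R).

Definition torsion (V : lmodType R) : set V :=
  [set x | exists n, forall a, ideal_pow m n a -> a *: x = 0].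

Section Resolution.
Variables (N : lmodType R) (I : injective_resolution N).

Definition lc_cocycles (i : nat) : set (res_obj I i) :=
  [set x | torsion x /\ res_diff I i x = 0].

Definition lc_coboundaries (i : nat) : set (res_obj I i) :=
  match i with
  | 0 => [set 0]
  | j.+1 => [set res_diff I j y | y in @torsion (res_obj I j)]
  end.

End Resolution.

Definition lc_vanishes (i : nat) (N : lmodType R) : Prop :=
  forall I : injective_resolution N,
    @lc_cocycles N I i = @lc_coboundaries N I i.

Definition lc_finite_length (i : nat) (N : lmodType R) : Prop :=
  forall I : injective_resolution N,
    finite_length_subquotient (@lc_cocycles N I i) (@lc_coboundaries N I i).

Definition generalized_cohen_macaulay : Prop :=
  forall i, lt_krull_dim R i -> lc_finite_length i R^o.

Definition maximal_cohen_macaulay (N : lmodType R) : Prop :=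
  [/\ exists x : N, x <> 0, fg_module N &
      forall i, lt_krull_dim R i -> lc_vanishes i N].

End LocalCohomology.

Section ResidueField.
Variables (R : comNzRingType) (m : set R) (k : fieldType).
Variable pi : {rmorphism R -> k}.

(* pi exhibits k as R/m *)
Definition residue_field : Prop :=
  (forall y, exists x, pi x = y) /\ (forall x, pi x = 0 <-> m x).

Definition subfield_set (L : set R) : Prop :=
  [/\ L 1, forall x y, L x -> L y -> L (x - y),
      forall x y, L x -> L y -> L (x * y) &
      forall x, L x -> x <> 0 -> exists2 y, L y & x * y = 1].

Definition coefficient_field (L : set R) : Prop :=
  subfield_set L /\ set_bij L setT pi.

End ResidueField.

Definition perfect_field (k : fieldType) : Prop :=
  forall p, p \in [pchar k] -> forall x : k, exists y, y ^+ p = x.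

Definition frob_push (R : comNzRingType) (p : nat) (hp : p \in [pchar R]) :
  Type := R.

Section FrobeniusPush.
Variables (R : comNzRingType) (p : nat) (hp : p \in [pchar R]).

HB.instance Definition _ := GRing.Zmodule.on (frob_push hp).

Definition frob_scale (r : R) (a : frob_push hp) : frob_push hp :=
  (r ^+ p * (a : R) : R).

Fact frob_scaleA a b v : frob_scale a (frob_scale b v) = frob_scale (a * b) v.
Proof. by rewrite /frob_scale exprMn mulrA. Qed.
Fact frob_scale1 : left_id 1 frob_scale.
Proof. by move=> v; rewrite /frob_scale expr1n mul1r. Qed.
Fact frob_scaleDr : right_distributive frob_scale +%R.
Proof. by move=> a u v; rewrite /frob_scale mulrDr. Qed.
Fact frob_scaleDl v : {morph frob_scale^~ v : a b / a + b}.
Proof.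
by move=> a b; rewrite /frob_scale -!(pFrobenius_autE hp) rmorphD mulrDl.
Qed.

HB.instance Definition _ := GRing.Zmodule_isLmodule.Build R (frob_push hp)
  frob_scaleA frob_scale1 frob_scaleDr frob_scaleDl.

Definition frob (r : R) : frob_push hp := (r ^+ p : R).

Definition F_finite : Prop := fg_module (frob_push hp).

Definition F_split : Prop :=
  exists phi : {linear frob_push hp -> R^o}, forall r : R, phi (frob r) = r.

(* F_*(R) = R (+) M, with R embedded by the Frobenius map and M by j *)
Definition F_splitting (M : lmodType R) (j : {linear M -> frob_push hp}) :
  Prop := bijective (fun x : R * M => frob x.1 + j x.2).

End FrobeniusPush.

(* Main.v *)
Require Import Defs.
From HB Require Import structures.
From mathcomp Require Import all_boot all_order all_algebra.
From mathcomp Require Import boolp classical_sets functions.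

Set Implicit Arguments.
Unset Strict Implicit.
Unset Printing Implicit Defensive.

Import GRing.Theory.
Local Open Scope ring_scope.
Local Open Scope classical_set_scope.

(* Let phi : F_*(R) -> R split the Frobenius map and let u_1, ..., u_q be elements
   of R such that (phi (u_i u_j)) is invertible; take q = 1 and u_1 = 1 when the
   residue field k is perfect, and u_1, ..., u_q in the coefficient field lifting
   a basis of k over k^p otherwise. Then x |-> (phi (u_i x))_i splits off R^q from
   F_*(R), with complement M say, so that F_*(H) = H^q (+) H^i_m(M) for
   H = H^i_m(R). Put Lambda = \sum_i R^p u_i, a subring with Lambda + m = R. If H
   has length l, then l is also the length of H over Lambda; pulling back the
   filtration C_j^q of H^q, for a composition series C_j of H, gives l + 1
   distinct Lambda-submodules of H, so that the kernel H^i_m(M) of the projection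
   to H^q vanishes.

   For the identification of F_*(H) one needs that H^i_m can be computed from
   F_*(E), where E is an injective resolution of R. The modules F_*(E_n) are not
   injective, but they are flasque (each Gamma_J of them is x-divisible modulo
   x-power torsion), and the torsion functor preserves exactness of bounded below
   exact complexes of flasque modules. *)

(** * Submodules and linear maps *)

Section Submodules.
Variables (R : comNzRingType) (V : lmodType R) (A : set V).
Implicit Type HA : submodule A.

Lemma submodule0 HA : A 0. Proof. by case: HA. Qed.

Lemma submoduleD HA u v : A u -> A v -> A (u + v).
Proof. by case: HA => _ H Au Av; rewrite -[u]scale1r; apply: H. Qed.

Lemma submoduleZ HA a u : A u -> A (a *: u).
Proof. by case: HA => A0 H Au; rewrite -[X in A X]addr0; apply: H. Qed.

Lemma submoduleN HA u : A u -> A (- u).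
Proof. by rewrite -scaleN1r; apply: submoduleZ. Qed.

Lemma submoduleB HA u v : A u -> A v -> A (u - v).
Proof. by move=> Au Av; apply: submoduleD => //; apply: submoduleN. Qed.

Lemma submodule_sum HA (I : Type) (r : seq I) (P : pred I) (F : I -> V) :
  (forall i, P i -> A (F i)) -> A (\sum_(i <- r | P i) F i).
Proof.
by move=> AF; elim/big_ind: _ => //; [apply: submodule0 | apply: submoduleD].
Qed.

Definition subm_pred : pred V := fun x => `[< A x >].

Fact subm_closed HA : submod_closed subm_pred.
Proof.
split; first by apply/asboolP; apply: submodule0.
by move=> a u v /asboolP Au /asboolP Av; apply/asboolP; case: HA => _; apply.
Qed.

Definition subm HA : Type := {x : V | subm_pred x}.

Section Instances.
Variable HA : submodule A.
HB.instance Definition _ := [isSub of subm HA for sval].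
HB.instance Definition _ := [Choice of subm HA by <:].
HB.instance Definition _ :=
  GRing.SubChoice_isSubLmodule.Build R V subm_pred (subm HA) (subm_closed HA).
End Instances.

Definition incl HA : {linear subm HA -> V} := val.

Lemma incl_inj HA : injective (incl HA). Proof. exact: val_inj. Qed.

Lemma inclP HA (x : subm HA) : A (incl HA x). Proof. exact/asboolP/(valP x). Qed.

Lemma incl_onto HA x : A x -> exists y : subm HA, incl HA y = x.
Proof. by move=> /asboolP Ax; exists (exist _ x Ax). Qed.

End Submodules.

Section Linear.
Variable R : comNzRingType.

Definition mklin (U V : lmodType R) (f : U -> V) (Hf : linear f) : {linear U -> V} :=
  HB.pack f (GRing.isLinear.Build R U V *:%R f Hf).

Lemma submodule_range (U V : lmodType R) (f : {linear U -> V}) :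
  submodule (range f).
Proof.
split; first by exists 0; [|exact: linear0].
by move=> a _ _ [x _ <-] [y _ <-]; exists (a *: x + y); [|exact: linearP].
Qed.

(** Factor [w] through the image of [u] and extend from that submodule of [V]. Since [u] may have a
    kernel, this serves both to lift chain maps and to define a map on a sum of two ideals. *)
Lemma injective_extend (E U V : lmodType R) (u : {linear U -> V})
    (w : {linear U -> E}) :
  injective_module E -> (forall x, u x = 0 -> w x = 0) ->
  exists g : {linear V -> E}, forall x, g (u x) = w x.
Proof.
move=> Einj uw; pose HA := submodule_range u.
have pre (y : subm HA) : {x | u x = incl HA y}.
  by apply: cid; have [x _ xy] := inclP y; exists x.
pose s y := w (sval (pre y)).
have sE y x : u x = incl HA y -> s y = w x.
  rewrite /s; case: (pre y) => z /= <- /eqP; rewrite -subr_eq0 -linearB.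
  by move=> /eqP /uw /eqP; rewrite linearB subr_eq0 => /eqP.
have slin : linear s.
  move=> a y z; have [[x xE] [t tE]] := (pre y, pre z).
  rewrite (sE _ _ xE) (sE _ _ tE) (sE _ (a *: x + t)) ?linearP //.
  by rewrite xE tE.
have [g gE] := Einj _ _ (incl HA) (mklin slin) (@incl_inj _ _ _ HA).
exists g => x; have [y yE] : exists y : subm HA, incl HA y = u x.
  by apply: incl_onto; exists x.
by rewrite -yE gE; apply: sE; rewrite yE.
Qed.

End Linear.

(** * Injective resolutions in characteristic p *)

(** Such a [V] is a vector space over F_p. Zorn's lemma gives a complement [C] of [A], and [e] is
    the projection onto [C] along [A]. *)
Lemma additive_projection (V : zmodType) (p : nat) (A : set V) :
  prime p -> (forall x : V, x *+ p = 0) ->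
  A 0 -> (forall u v, A u -> A v -> A (u - v)) ->
  exists e : V -> V, [/\ forall x y, e (x + y) = e x + e y,
    forall x, A (x - e x) & forall x, e x = 0 <-> A x].
Proof.
move=> p_pr pV A0 AB.
have subgD (D : set V) u v : (D 0) -> (forall u v, D u -> D v -> D (u - v)) ->
    D u -> D v -> D (u + v).
  move=> D0 DB Du Dv; rewrite -[v]opprK -[- v]sub0r.
  by apply: (DB) => //; apply: DB.
(* [P] does not ask that 0 be in [C]: the union of the empty chain has to satisfy it. *)
pose P (C : set V) := (forall u v, C u -> C v -> C (u - v)) /\
  (forall u, C u -> A u -> u = 0).
have [C [[CB CA] Cmax]] : exists C, P C /\ forall B, C `<` B -> ~ P B.
  apply: Zorn_bigcup => F FP Ftot; split; last first.
    by move=> u [C FC Cu]; apply: (FP C FC).2.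
  move=> u v [C FC Cu] [D FD Dv]; have [CD|DC] := Ftot C D FC FD.
    by exists D => //; apply: (FP D FD).1 => //; apply: CD.
  by exists C => //; apply: (FP C FC).1 => //; apply: DC.
have maxC B x : C `<=` B -> P B -> B x -> C x.
  move=> CleB PB Bx; apply: contrapT => nCx.
  by apply: (Cmax B) => //; split => // /(_ _ Bx).
have C0 : C 0.
  have [Ce|/existsNP[u /contrapT Cu]] := pselect (forall u, ~ C u); last first.
    by rewrite -(subrr u); apply: CB.
  apply: (maxC [set 0]) => //=; first by move=> u /Ce.
    by split=> //= u v -> ->; rewrite subrr.
have dec x : exists a c, [/\ A a, C c & x = a + c].
  apply: contrapT => nx.
  (* This is [C] + F_p [x]. An element c + n x of [A] lies in [C] if p divides n; otherwise it would
     put [x] in [A] + [C]. *)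
  pose B := [set u | exists c n, C c /\ u = c + x *+ n].
  suff Cx : C x by apply: nx; exists 0, x; rewrite add0r.
  apply: (maxC B); last by exists 0, 1%N; rewrite add0r.
    by move=> c Cc; exists c, 0%N; rewrite addr0.
  split.
    move=> _ _ [c [n [Cc ->]]] [d [k [Cd ->]]].
    exists (c - d), (n + p.-1 * k)%N; split; first exact: CB.
    have xE : x *+ (p.-1 * k) = - (x *+ k).
      apply/eqP; rewrite -addr_eq0 -mulrnDr addnC -mulSn prednK ?prime_gt0 //.
      by rewrite mulnC mulrnA pV.
    by rewrite mulrnDr xE opprD addrACA.
  move=> u [c [n [Cc uE]]] Au.
  have [/dvdnP[k nE]|pn] := boolP (p %| n)%N.
    move: uE Au; rewrite nE mulrnA pV addr0 => -> Ac; exact: CA.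
  case: nx; have : coprime n p by rewrite coprime_sym prime_coprime.
  have [k _] := Bezoutr n (prime_gt0 p_pr); rewrite /coprime => + /eqP gE.
  rewrite gE => /dvdnP[l lE].
  (* Bezout gives k n = -1 mod p, so k (p - 1) is an inverse of n mod p. *)
  have xE : x = (u - c) *+ (k * (p.-1)).
    have -> : u - c = x *+ n by rewrite uE addrC addKr.
    have := congr1 (fun t => x *+ t) lE.
    rewrite mulrnA pV mulrnDr mulr1n => /eqP; rewrite addr_eq0 => /eqP xE.
    have h : x *+ (n * k) *+ p.-1 = - (x *+ (n * k)).
      apply/eqP; rewrite -addr_eq0 addrC -mulrS prednK ?prime_gt0 //.
      by rewrite pV.
    by rewrite -!mulrnA mulnA mulrnA h {1}xE mulnC.
  have mulA (D : set V) y j : D 0 -> (forall v w, D v -> D w -> D (v - w)) ->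
      D y -> D (y *+ j).
    move=> D0 DB Dy; elim: j => // j IH; rewrite mulrS.
    exact: subgD.
  exists (u *+ (k * p.-1)), (- (c *+ (k * p.-1))); split; first exact: mulA.
    by rewrite -sub0r; apply: (CB) => //; apply: mulA.
  by rewrite {1}xE mulrnBl.
have /choice[e eP] : forall x, exists c, A (x - c) /\ C c.
  by move=> x; have [a [c [Aa Cc ->]]] := dec x; exists c; rewrite addrK.
have eE x c : A (x - c) -> C c -> e x = c.
  move=> Axc Cc; have [Ae Ce] := eP x; apply/eqP; rewrite -subr_eq0; apply/eqP.
  apply: (CA); first exact: (CB).
  by have := AB _ _ Axc Ae; rewrite opprB addrC addrA subrK.
exists e; split.
- move=> x y; have [[Ax Cx] [Ay Cy]] := (eP x, eP y).
  by apply: eE; rewrite ?opprD 1?addrACA; [apply: subgD | apply: subgD].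
- by move=> x; have [] := eP x.
- move=> x; split=> [ex|Ax]; first by have [] := eP x; rewrite ex subr0.
  by apply: eE => //; rewrite subr0.
Qed.

(** * Cofree modules *)

Section Coinduced.
Variables (R : comNzRingType) (V : lmodType R).

Definition coind_pred : pred (R -> V) :=
  fun h => `[< forall a b, h (a + b) = h a + h b >].

Fact coind_closed : zmod_closed coind_pred.
Proof.
split; first by apply/asboolP => a b; rewrite /= addr0.
move=> f g /asboolP fD /asboolP gD; apply/asboolP => a b.
by rewrite !fctE fD gD opprD addrACA.
Qed.

(* Hom_Z(R, V), the cofree R-module on V: (r h)(s) = h (s r) *)
Definition coind : Type := {h : R -> V | coind_pred h}.

HB.instance Definition _ := [isSub of coind for sval].
HB.instance Definition _ := [Choice of coind by <:].
HB.instance Definition _ :=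
  GRing.SubChoice_isSubZmodule.Build (R -> V) coind_pred coind coind_closed.

Lemma coindD (h : coind) a b : val h (a + b) = val h a + val h b.
Proof. by have /asboolP := valP h. Qed.

Lemma coind_ext (h h' : coind) : (forall s, val h s = val h' s) -> h = h'.
Proof. by move=> E; apply/val_inj/funext. Qed.

Fact coind_scale_closed r (h : coind) : coind_pred (fun s => val h (s * r)).
Proof. by apply/asboolP => a b; rewrite mulrDl coindD. Qed.

Definition coind_scale r (h : coind) : coind :=
  @exist _ (fun h => coind_pred h) _ (coind_scale_closed r h).

Fact coind_scaleA a b h :
  coind_scale a (coind_scale b h) = coind_scale (a * b) h.
Proof. by apply: coind_ext => s /=; rewrite mulrA. Qed.
Fact coind_scale1 : left_id 1 coind_scale.
Proof. by move=> h; apply: coind_ext => s /=; rewrite mulr1. Qed.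
Fact coind_scaleDr : right_distributive coind_scale +%R.
Proof. by move=> a f g; apply: coind_ext => s. Qed.
Fact coind_scaleDl h : {morph coind_scale^~ h : a b / a + b}.
Proof.
by move=> a b; apply: coind_ext => s /=; rewrite mulrDr coindD.
Qed.

HB.instance Definition _ := GRing.Zmodule_isLmodule.Build R coind
  coind_scaleA coind_scale1 coind_scaleDr coind_scaleDl.
End Coinduced.

Section CharP.
Variables (R : comNzRingType) (p : nat) (hp : p \in [pchar R]).

Lemma pchar_scale (V : lmodType R) (x : V) : x *+ p = 0.
Proof. by rewrite -scaler_nat (pcharf0 hp) scale0r. Qed.

(* In characteristic p subgroups of modules have additive complements, so that
   Hom_Z(R, V) is injective without V being divisible. *)
Lemma submodule_projection (V : lmodType R) (A : set V) : submodule A ->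
  exists e : V -> V, [/\ forall x y, e (x + y) = e x + e y,
    forall x, A (x - e x) & forall x, e x = 0 <-> A x].
Proof.
move=> HA; apply: additive_projection (pcharf_prime hp) _ _ _.
- exact: pchar_scale.
- exact: submodule0.
- by move=> u v; apply: submoduleB.
Qed.

(** Linear maps into Hom_Z(R, V) correspond to additive maps into V, by evaluation at 1. The latter
    extend along [i] by composition with an additive retraction [s] of [i]. *)
Lemma coind_injective (V : lmodType R) : injective_module (coind V).
Proof.
move=> A B i f i_inj.
have [e [eD Ae e0]] := submodule_projection (submodule_range i).
have /choice[s sE] : forall b, exists a, i a = b - e b.
  by move=> b; have [a _ aE] := Ae b; exists a.
have sD x y : s (x + y) = s x + s y.
  by apply: i_inj; rewrite linearD !sE eD opprD addrACA.
have si x : s (i x) = x.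
  apply: i_inj; rewrite sE.
  have /e0 -> : range i (i x) by exists x.
  by rewrite subr0.
have gP b : coind_pred (fun r => val (f (s (r *: b))) 1).
  by apply/asboolP => x y; rewrite scalerDl sD linearD.
pose g b : coind V := @exist _ (fun h => coind_pred h) _ (gP b).
have glin : linear g.
  move=> a x y; apply: coind_ext => r /=.
  by rewrite scalerDr sD linearD scalerA.
exists (mklin glin) => x; apply: coind_ext => r /=.
by rewrite -[r *: _]linearZ si linearZ /= mul1r.
Qed.

(** The map x |-> (r |-> e (r x)), for [e] additive with kernel [A], embeds V/A in an injective
    module without forming the quotient. *)
Lemma coind_kernel (V : lmodType R) (A : set V) : submodule A ->
  exists d : {linear V -> coind V}, forall x, d x = 0 <-> A x.
Proof.
move=> HA; have [e [eD Ae e0]] := submodule_projection HA.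
have dP b : coind_pred (fun r => e (r *: b)).
  by apply/asboolP => x y; rewrite scalerDl eD.
pose d b : coind V := @exist _ (fun h => coind_pred h) _ (dP b).
have dlin : linear d.
  by move=> a x y; apply: coind_ext => r /=; rewrite scalerDr eD scalerA.
exists (mklin dlin) => x; split=> [dx|Ax].
  by apply/e0; rewrite -[x]scale1r; have /(congr1 (fun h => val h 1)) := dx.
by apply: coind_ext => r /=; apply/e0; apply: submoduleZ.
Qed.

(** Each stage pairs a module with the image of the map into it, and the next map is chosen with
    that image as kernel. As [lc_finite_length] quantifies over resolutions, one has to exist for it
    to yield anything. *)
Lemma injective_resolution_exists (N : lmodType R) :
  inhabited (injective_resolution N).
Proof.
have N0 : submodule [set 0 : N].
  by split=> //= a u v -> ->; rewrite scaler0 addr0.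
have [aug augE] := coind_kernel N0.
pose st := {V : lmodType R & {A : set V | submodule A}}.
pose d (s : st) : {linear tag s -> coind (tag s)} :=
  sval (cid (coind_kernel (svalP (tagged s)))).
have dE (s : st) x : d s x = 0 <-> sval (tagged s) x.
  by rewrite /d; case: cid.
pose mk (V W : lmodType R) (f : {linear V -> W}) : st :=
  existT _ W (exist _ (range f) (submodule_range f)).
pose E := fix E n : st := if n is n'.+1 then mk _ _ (d (E n')) else mk _ _ aug.
have rangeE (U V : lmodType R) (f : {linear U -> V}) x :
  range f x <-> exists y, f y = x.
  by split=> [[y _ <-]|[y <-]]; exists y.
have inj n : injective_module (tag (E n)).
  by case: n => [|n]; apply: coind_injective.
have aug_inj : injective aug.
  by move=> x y /eqP; rewrite -subr_eq0 -linearB => /eqP /augE /= /eqP;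
    rewrite subr_eq0 => /eqP.
split; apply: (@InjectiveResolution R N (fun n => tag (E n)) aug
  (fun n => d (E n)) inj aug_inj) => [x|n x]; by rewrite dE -rangeE.
Qed.

End CharP.

(** * Noetherian rings and torsion *)

Section Noetherian.
Variable R : comNzRingType.
Implicit Types (A B : set R) (J : seq R).

(** The union of a nonempty chain of ideals is finitely generated, and its generators already lie in
    one member of the chain. *)
Lemma noetherian_maximal (F : set (set R)) : noetherian R ->
  (forall A, F A -> ideal A) -> F !=set0 ->
  exists B, F B /\ forall C, F C -> B `<=` C -> C `<=` B.
Proof.
move=> noeth Fid [A0 FA0].
(* The empty set is added to the family to account for the empty chain. *)
pose P A := (A = set0) \/ F A.
have [B [PB Bmax]] : exists B, P B /\ forall C, B `<` C -> ~ P C.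
  apply: Zorn_bigcup => G GP Gtot.
  have [Ge|/existsNP[A1 /not_implyP[GA1 A1e]]] :=
      pselect (forall A, G A -> A = set0).
    by left; rewrite -subset0 => x [A GA]; rewrite (Ge A GA).
  right; have FA1 : F A1 by case: (GP _ GA1).
  set U := \bigcup_(X in G) X.
  have idG A x : G A -> A x -> ideal A.
    by move=> /GP[->//|FA] _; apply: Fid.
  have idU : ideal U.
    split; first by exists A1 => //; apply: (submodule0 (Fid _ FA1)).
    move=> a x y [A GA Ax] [B GB By].
    have [AB|BA] := Gtot A B GA GB.
      by exists B => //; case: (idG B y GB By) => _; apply => //; apply: AB.
    by exists A => //; case: (idG A x GA Ax) => _; apply => //; apply: BA.
  have [n [x UE]] := noeth U idU.
  suff [A [GA A1A xA]] : exists A, [/\ G A, A1 `<=` A & forall i, A (x i)].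
    suff -> : U = A by case: (GP A GA) => // Ae; move: A1e; case;
      rewrite -subset0 -Ae.
    have idA : ideal A.
      by apply: (idG A 0) => //; apply: A1A; apply: (submodule0 (Fid _ FA1)).
    apply/seteqP; split; last by move=> y Ay; exists A.
    rewrite UE => _ [c ->]; apply: (@submodule_sum R R^o A idA) => i _.
    exact: (@submoduleZ R R^o).
  have Ux i : U (x i).
    rewrite UE; exists (fun j => (j == i)%:R).
    rewrite (bigD1 i) //= eqxx scale1r big1 ?addr0 // => j /negPf ->.
    by rewrite scale0r.
  suff [A [GA A1A xA]] : exists A,
      [/\ G A, A1 `<=` A & forall i, i \in enum 'I_n -> A (x i)].
    by exists A; split=> // i; apply: xA; rewrite mem_enum.
  elim: (enum 'I_n) => [|i s [A [GA A1A xA]]]; first by exists A1; split.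
  have [B GB Bx] := Ux i.
  have [AB|BA] := Gtot A B GA GB.
    exists B; split=> //; first exact: subset_trans AB.
    by move=> j; rewrite inE => /predU1P[->//|/xA]; apply: AB.
  exists A; split=> // j; rewrite inE => /predU1P[->|/xA //]; exact: BA.
have FB : F B.
  case: PB => // Be; exfalso; apply: (Bmax A0); last by right.
  split; first by rewrite Be.
  by rewrite Be => /(_ 0); apply; apply: (submodule0 (Fid _ FA0)).
exists B; split=> // C FC BC x Cx; apply: contrapT => nBx.
by apply: (Bmax C); [split=> // /(_ _ Cx)|right].
Qed.

Lemma ideal_colon A y : ideal A -> ideal [set r | A (y * r)].
Proof.
move=> idA; split=> /=; first by rewrite mulr0; apply: (submodule0 idA).
move=> a u v Au Av; rewrite mulrDr mulrCA.
by case: idA => _; apply.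
Qed.

(** The colon ideals (A : y^n) increase with n; [l] is the index of a maximal one. *)
Lemma colon_stable A y : noetherian R -> ideal A ->
  exists l, forall k r, A (y ^+ (l + k) * r) -> A (y ^+ l * r).
Proof.
move=> noeth idA.
pose F := [set [set r | A (y ^+ n * r)] | n in setT].
have Fid B : F B -> ideal B by move=> [n _ <-]; apply: ideal_colon.
have F0 : F !=set0 by exists [set r | A (y ^+ 0 * r)], 0%N.
have [_ [[l _ <-] lmax]] := noetherian_maximal noeth Fid F0.
exists l => k r Ar.
apply: (lmax [set r | A (y ^+ (l + k) * r)]) => //; first by exists (l + k)%N.
by move=> s /= As; rewrite addnC exprD -mulrA; apply: (@submoduleZ R R^o).
Qed.

Section Torsion.
Variable V : lmodType R.

Definition tor J : set V := [set e | forall y, y \in J -> exists n, y ^+ n *: e = 0].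

Lemma tor_cons y J e :
  tor (y :: J) e <-> (exists n, y ^+ n *: e = 0) /\ tor J e.
Proof.
split=> [T|[Ty TJ] z]; last by rewrite inE => /predU1P[->|/TJ].
by split=> [|z zJ]; apply: T; rewrite inE ?eqxx ?zJ ?orbT.
Qed.

Lemma scale_exp_le y n k (e : V) : (n <= k)%N -> y ^+ n *: e = 0 ->
  y ^+ k *: e = 0.
Proof. by move=> /subnK <- E; rewrite exprD -scalerA E scaler0. Qed.

Lemma submodule_tor J : submodule (tor J).
Proof.
split=> [y _|a u v Tu Tv y yJ]; first by exists 0%N; rewrite scaler0.
have [[n nE] [k kE]] := (Tu y yJ, Tv y yJ); exists (maxn n k).
rewrite scalerDr scalerA mulrC -scalerA.
by rewrite (scale_exp_le (leq_maxl _ _) nE) (scale_exp_le (leq_maxr _ _) kE)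
  scaler0 addr0.
Qed.

(** For the converse, let [A N] be maximal among the ideals [A n] of those r with m^n r e = 0. Were
    1 not in it, a maximal colon ideal (A N : r) with r outside [A N] would contain each generator
    of m, hence m, and then r would lie in [A N] by maximality of the latter. *)
Lemma torsionP (m : set R) k (x : 'I_k -> R) (e : V) : noetherian R ->
    ideal m -> m = @Defs.span R R^o k x ->
  torsion m e <-> tor (codom x) e.
Proof.
move=> noeth idm mE; split=> [[n nE] y /codomP[i ->]|T].
  exists n; apply: nE; have my : m (x i).
    rewrite mE; exists (fun t => (t == i)%:R).
    rewrite (bigD1 i) //= eqxx scale1r big1 ?addr0 // => t /negPf ->.
    by rewrite scale0r.
  elim: n => //= n IH; rewrite exprS; exists 1%N, (fun=> x i), (fun=> x i ^+ n).
  by split=> //; rewrite big_ord1.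
pose A n := [set r : R | forall a, ideal_pow m n a -> (a * r) *: e = 0].
have idA n : ideal (A n).
  split=> [a _|r u v Au Av a ma] /=; first by rewrite mulr0 scale0r.
  have -> : a * (r *: u + v) = r * (a * u) + a * v by rewrite mulrDr mulrCA.
  by rewrite scalerDl -scalerA (Au a ma) (Av a ma) scaler0 addr0.
have idpow n a r : ideal_pow m n a -> ideal_pow m n (r * a).
  case: n => //= n [l [b [c [mb mc ->]]]].
  exists l, (fun i => r * b i), c; split=> //.
    by move=> i; apply: (@submoduleZ R R^o).
  by rewrite mulr_sumr; apply: eq_bigr => i _; rewrite mulrA.
have Aid B : [set A n | n in setT] B -> ideal B by move=> [n _ <-].
have AN0 : [set A n | n in setT] !=set0 by exists (A 0%N), 0%N.
have [_ [[N _ <-] Nmax]] := noetherian_maximal noeth Aid AN0.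
have AS r : (forall y, m y -> A N (y * r)) -> A N r.
  move=> Ar; apply: (Nmax (A N.+1)); first by exists N.+1.
    move=> s /= As a [l [b [c [mb mc ->]]]].
    rewrite mulr_suml scaler_suml big1 // => i _.
    by rewrite -mulrA -scalerA (As _ (mc i)) scaler0.
  rewrite /=; move=> a [l [b [c [mb mc ->]]]].
  rewrite mulr_suml scaler_suml big1 // => i _.
  rewrite [b i * _]mulrC -mulrA; exact: (Ar _ (mb i) _ (mc i)).
suff A1 : A N 1 by exists N => a /A1; rewrite mulr1.
apply: contrapT => nA1.
pose F := [set [set s | A N (r * s)] | r in [set r | ~ A N r]].
have Fid B : F B -> ideal B by move=> [r _ <-]; apply: ideal_colon.
have F0 : F !=set0 by exists [set s | A N (1 * s)], 1.
have [_ [[r nAr <-] rmax]] := noetherian_maximal noeth Fid F0.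
apply: nAr; apply: AS.
have AJ y : y \in codom x -> A N (y * r).
  move=> yJ; apply: contrapT => nAy.
  (* As y r is outside [A N], maximality gives (A N : y r) = (A N : r), so the factors y of y^n r
     can be cancelled one by one. *)
  have step s : A N (y * r * s) -> A N (r * s).
    move=> As; apply: (rmax [set s | A N (y * r * s)]) => //.
      by exists (y * r).
    move=> t At; have := @submoduleZ R R^o _ (idA N) y _ At.
    by rewrite -[y *: _]/(y * (r * t)) mulrA.
  have [n nE] := T y yJ.
  have : A N (r * y ^+ n).
    by move=> a _; rewrite mulrA -scalerA nE scaler0.
  elim: n {nE} => [|n IH].
    by rewrite mulr1 => Ar; apply: nAy; apply: (@submoduleZ R R^o _ (idA N)).
  by rewrite exprS mulrA [r * y]mulrC => /step /IH.
move=> y; rewrite mE => -[c ->].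
rewrite mulr_suml; apply: (@submodule_sum R R^o _ (idA N)) => i _.
rewrite -[c i *: _]/(c i * _) -mulrA; apply: (@submoduleZ R R^o _ (idA N)).
exact/AJ/codom_f.
Qed.

End Torsion.
End Noetherian.

(** * Flasque modules *)

Section Flasque.
Variable R : comNzRingType.
Implicit Types (V W : lmodType R) (J : seq R).

(* [tor J] is Gamma_J. Injective modules over Noetherian rings have this property,
   and it is elementary enough to be inherited by Frobenius pushforwards. *)
Definition flasque V (A : set V) : Prop := forall J x e, A e -> tor J e ->
  exists e' N, [/\ A e', tor J e' & x ^+ N *: (e - x *: e') = 0].

Lemma flasque_iter V (A : set V) n J x e : flasque A -> A e -> tor J e ->
  exists e' N, [/\ A e', tor J e' & x ^+ N *: (e - x ^+ n *: e') = 0].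
Proof.
move=> fA Ae Te; elim: n => [|n [e1 [N [Ae1 Te1 E1]]]].
  by exists e, 0%N; split=> //; rewrite expr0 !scale1r subrr.
have [e2 [K [Ae2 Te2 E2]]] := fA J x e1 Ae1 Te1.
exists e2, (N + K)%N; split=> //.
have -> : e - x ^+ n.+1 *: e2 = (e - x ^+ n *: e1) + x ^+ n *: (e1 - x *: e2).
  by rewrite scalerBr scalerA -exprSr addrA subrK.
rewrite scalerDr (scale_exp_le (leq_addr _ _) E1) add0r scalerA mulrC -scalerA.
by rewrite (scale_exp_le (leq_addl _ _) E2) scaler0.
Qed.

Section Image.
Variables (V W : lmodType R) (f : {linear V -> W}).
Hypotheses (fV : flasque [set: V]) (fK : flasque [set v | f v = 0]).

(** Induction on [J]: if v lifts w and y^n w = 0, then y^n v lies in the kernel, and flasqueness of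
    the kernel yields a correction [a] there that makes v - a also y-power torsion. *)
Lemma flasque_tor_lift J w : range f w -> tor J w -> exists2 v, tor J v & f v = w.
Proof.
move=> fw; elim: J => [|y J IH]; first by case: fw => v _ <- _; exists v.
move=> /tor_cons [[n yw] /IH[v Tv fvw]].
have [|a [N [fa Ta aE]]] := @flasque_iter _ _ n J y (y ^+ n *: v) fK _
    (submoduleZ (submodule_tor V J) _ Tv).
  by rewrite /= linearZ /= fvw.
exists (v - a); last by rewrite linearB fvw fa subr0.
apply/tor_cons; split; last exact: (submoduleB (submodule_tor V J) Tv Ta).
by exists (N + n)%N; rewrite exprD -scalerA scalerBr.
Qed.

(** A quotient of a flasque module by a flasque submodule is flasque: lift the torsion element,
    divide it upstairs and map back. *)
Lemma flasque_range : flasque (range f).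
Proof.
move=> J x e fe /(flasque_tor_lift fe)[v Tv <-].
have [v' [N [_ Tv' E]]] := fV x I Tv.
exists (f v'), N; split; first by exists v'.
- by move=> y /Tv'[n nE]; exists n; rewrite -linearZ nE linear0.
- by rewrite -linearZ -linearB -linearZ E linear0.
Qed.
End Image.

Lemma flasque_set0 V : flasque [set 0 : V].
Proof.
move=> J x _ -> T; exists 0, 0%N; split=> //.
by rewrite scaler0 subrr scaler0.
Qed.

Lemma tor_linear V W (f : {linear V -> W}) J v : tor J v -> tor J (f v).
Proof. by move=> T y /T[n nE]; exists n; rewrite -linearZ nE linear0. Qed.

Lemma flasque_prod V W : flasque [set: V] -> flasque [set: W] ->
  flasque [set: V * W].
Proof.
move=> fV fW J x [v w] _ T.
have Tv : tor J v by exact: (@tor_linear _ _ fst _ _ T).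
have Tw : tor J w by exact: (@tor_linear _ _ snd _ _ T).
have [v' [N [_ Tv' vE]]] := fV J x v I Tv.
have [w' [K [_ Tw' wE]]] := fW J x w I Tw.
exists (v', w'), (maxn N K); split=> //.
  move=> y yJ; have [[n nE] [k kE]] := (Tv' y yJ, Tw' y yJ).
  exists (maxn n k); congr pair => /=.
    exact: scale_exp_le (leq_maxl _ _) nE.
  exact: scale_exp_le (leq_maxr _ _) kE.
congr pair => /=.
  exact: scale_exp_le (leq_maxl _ _) vE.
exact: scale_exp_le (leq_maxr _ _) wE.
Qed.

Lemma flasque_fun q V : flasque [set: V] -> flasque [set: 'I_q -> V].
Proof.
move=> fV J x v _ T.
have Tv i : tor J (v i).
  by move=> y /T[n nE]; exists n; have := congr1 (fun h => h i) nE.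
have /choice[v' v'E] i : exists v' : V, tor J v' /\
    exists N, x ^+ N *: (v i - x *: v') = 0.
  by have [v' [N [_ Tv' vE]]] := fV J x (v i) I (Tv i); exists v'; split=> //; exists N.
have /choice[N NE] i := (v'E i).2.
exists v', (\max_i N i); split=> //.
  move=> y yJ; have /choice[n nE] i := (v'E i).1 y yJ.
  exists (\max_i n i); apply: funext => i.
  exact: scale_exp_le (leq_bigmax i) (nE i).
apply: funext => i; exact: scale_exp_le (leq_bigmax i) (NE i).
Qed.

(* The extension problem defining e' is posed on the ideal (x^(N+1)) + B, where
   B contains a power of each y in J and B cap (x^(N+1)) = x^(N+1) ann(e): this
   replaces the Artin-Rees lemma. *)
Lemma injective_flasque (E : lmodType R) :
  noetherian R -> injective_module E -> flasque [set: E].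
Proof.
move=> noeth Einj J x e _ Te.
have id0 : ideal [set 0 : R].
  by split=> //= a u v -> ->; rewrite scaler0 addr0.
(* From exponent [N] on, the annihilator of x^N no longer grows; this makes the map [w] below well
   defined. *)
have [N Nstab] := colon_stable x noeth id0.
pose U := [set r | exists a, r = x ^+ N.+1 * a].
pose U' := [set r | exists a, a *: e = 0 /\ r = x ^+ N.+1 * a].
pose F := [set B : set R | [/\ ideal B, U' `<=` B & forall r, B r -> U r -> U' r]].
have Fid B : F B -> ideal B by case.
have F0 : F !=set0.
  exists U'; split=> //; split; first by exists 0; rewrite scale0r mulr0.
  move=> c _ _ [a [aE ->]] [b [bE ->]]; exists (c * a + b).
  split; first by rewrite scalerDl -scalerA aE bE scaler0 addr0.
  by rewrite -[c *: _]/(c * _) mulrDr mulrCA.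
have [B [[idB UB BU] Bmax]] := noetherian_maximal noeth Fid F0.
have BJ y : y \in J -> exists n, B (y ^+ n).
  move=> yJ; have [n nE] := Te y yJ; have [l lstab] := colon_stable y noeth idB.
  pose L := (n + l)%N; exists L.
  have yL : y ^+ L *: e = 0 by apply: scale_exp_le nE; apply: leq_addr.
  (* Adding y^L to [B] creates no new intersection with [U]: if r = b + y^L c is in [U], then y^L r
     is in [U'], so y^(2L) c is in [B], and stability brings y^L c back into [B]. *)
  pose B' := [set r | exists b c, B b /\ r = b + y ^+ L * c].
  apply: (Bmax B'); last 1 first.
  - exists 0, 1; split; first exact: (submodule0 idB).
    by rewrite mulr1 add0r.
  - have BB' : B `<=` B' by move=> b Bb; exists b, 0; rewrite mulr0 addr0.
    split; last 2 first.
    + exact: subset_trans BB'.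
    + move=> r [b [c [Bb rE]]] [d rE'].
      have : B (y ^+ L * r).
        apply: UB; exists (y ^+ L * d); split; last by rewrite rE' mulrCA.
        by rewrite mulrC -scalerA yL scaler0.
      rewrite rE mulrDr => BL.
      have BLb : B (y ^+ L * b) by apply: (@submoduleZ R R^o).
      have := @submoduleB R R^o _ idB _ _ BL BLb.
      rewrite addrAC subrr add0r mulrA -exprD.
      rewrite [X in y ^+ X](_ : _ = l + (n + L))%N; last first.
        by rewrite /L [in LHS]addnC [(n + l)%N]addnC -addnA addnCA addnA.
      move=> /lstab Bl; apply: BU; last by exists d; rewrite -rE.
      apply: (@submoduleD R R^o) => //.
      by rewrite exprD -mulrA; apply: (@submoduleZ R R^o).
    + split; first by apply: BB'; apply: (submodule0 idB).
    move=> a _ _ [b [c [Bb ->]]] [b' [c' [Bb' ->]]].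
    exists (a * b + b'), (a * c + c'); split.
      by case: idB => _; apply.
    by rewrite -[a *: _]/(a * _) !mulrDr addrACA [a * (_ * c)]mulrCA.
  - by move=> b Bb; exists b, 0; rewrite mulr0 addr0.
pose u (z : R^o * subm idB) : R^o := z.1 * x ^+ N.+1 + incl idB z.2.
have ulin : linear u.
  move=> a [r b] [r' b']; rewrite /u [incl _ _]linearP /=.
  set i := incl idB b; set i' := incl idB b'.
  change ((a * r + r') * x ^+ N.+1 + (a * i + i') =
    a * (r * x ^+ N.+1 + i) + (r' * x ^+ N.+1 + i')).
  by rewrite mulrDl mulrDr mulrA addrACA.
pose w (z : R^o * subm idB) : E := (z.1 * x ^+ N) *: e.
have wlin : linear w.
  move=> a [r b] [r' b']; rewrite /w /= -[a *: r]/(a * r).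
  by rewrite mulrDl scalerDl scalerA mulrA.
(* The map r x^(N+1) + b |-> r x^N e extends to R. Its value at 1 is e': it is killed by the powers
   of y in [B], and x^(N+1) e' = x^N e. *)
have [|g gE] := @injective_extend R E _ _ (mklin ulin) (mklin wlin) Einj.
  move=> [r b] rb0; have bE : incl idB b = - (r * x ^+ N.+1).
    by apply/eqP; rewrite -addr_eq0 addrC; apply/eqP.
  have [a [ae]] : U' (incl idB b).
    by apply: BU (inclP b) _; exists (- r); rewrite bE mulrN [x ^+ _ * r]mulrC.
  rewrite bE => aE; have : x ^+ (N + 1) * (r + a) = 0.
    by rewrite addn1 mulrDr -aE mulrC subrr.
  move=> /Nstab /= /eqP; rewrite mulrDr addr_eq0 => /eqP rE.
  by rewrite /w /= mulrC rE scaleNr -scalerA ae scaler0 oppr0.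
have g1 r : g r = r *: g 1 by rewrite -linearZ /= -[r *: 1]/(r * 1) mulr1.
have gE' r b : g (r * x ^+ N.+1 + incl idB b) = (r * x ^+ N) *: e := gE (r, b).
exists (g 1), N; split=> //.
  move=> y /BJ[n yB]; exists n; have [b bE] := incl_onto idB yB.
  by have := gE' 0 b; rewrite !mul0r add0r scale0r bE g1.
have := gE' 1 0; rewrite linear0 addr0 !mul1r g1 => E1.
by rewrite scalerBr scalerA -exprSr E1 subrr.
Qed.

End Flasque.

(** * Comparison of complexes *)

Section Coboundaries.
Variables (R : comNzRingType) (Y : nat -> lmodType R).
Variables (dY : forall n, {linear Y n -> Y n.+1}).

(** The counterpart of [lc_coboundaries] for complexes that are not injective resolutions. *)
Definition tor_coboundaries (J : seq R) n : set (Y n) :=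
  match n with
  | 0 => [set 0]
  | n'.+1 => [set dY n' y | y in @tor R (Y n') J]
  end.

Lemma submodule_tor_coboundaries J n : submodule (@tor_coboundaries J n).
Proof.
case: n => [|n]; first by split=> //= a x y -> ->; rewrite scaler0 addr0.
split; first by exists 0; [exact: (submodule0 (submodule_tor _ _))|exact: linear0].
move=> a _ _ [x Tx <-] [y Ty <-]; exists (a *: x + y); last exact: linearP.
exact: (submodule_tor _ _).2.
Qed.

Lemma tor_coboundaries_sub J n (x : Y n) :
  (forall n x, dY n.+1 x = 0 <-> exists y, dY n y = x) ->
  tor_coboundaries J x -> tor J x /\ dY n x = 0.
Proof.
move=> exY; case: n x => [_ ->|n _ [y Ty <-]] /=.
  by split; [exact: (submodule0 (submodule_tor _ _))|exact: linear0].
by split; [exact: tor_linear|apply/exY; exists y].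
Qed.

End Coboundaries.

Lemma tor_coboundaries_map (R : comNzRingType) (X Y : nat -> lmodType R)
    (dX : forall n, {linear X n -> X n.+1})
    (dY : forall n, {linear Y n -> Y n.+1})
    (f : forall n, {linear X n -> Y n}) J n (x : X n) :
  (forall n x, f n.+1 (dX n x) = dY n (f n x)) ->
  tor_coboundaries dX J x -> tor_coboundaries dY J (f n x).
Proof.
move=> fd; case: n x => [_ ->|n _ [y Ty <-]] /=; first exact: linear0.
by rewrite fd; exists (f n y) => //; apply: tor_linear.
Qed.

Section Complexes.
Variable R : comNzRingType.
Variables (X Y : nat -> lmodType R).
Variables (dX : forall n, {linear X n -> X n.+1}).
Variables (dY : forall n, {linear Y n -> Y n.+1}).
Hypothesis exX : forall n x, dX n.+1 x = 0 <-> exists y, dX n y = x.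
Hypothesis exY : forall n x, dY n.+1 x = 0 <-> exists y, dY n y = x.

Lemma complexX n x : dX n.+1 (dX n x) = 0. Proof. by apply/exX; exists x. Qed.
Lemma complexY n x : dY n.+1 (dY n x) = 0. Proof. by apply/exY; exists x. Qed.

Lemma chain_map_exists (N : lmodType R) (aug : {linear N -> X 0})
    (w : {linear N -> Y 0}) :
  (forall n, injective_module (Y n)) -> injective aug ->
  (forall x, dX 0 x = 0 <-> exists y, aug y = x) ->
  (forall x, dY 0 (w x) = 0) ->
  exists f : forall n, {linear X n -> Y n},
    (forall x, f 0%N (aug x) = w x) /\
    forall n x, f n.+1 (dX n x) = dY n (f n x).
Proof.
move=> Yinj aug_inj ex0 w0.
(* Each component is carried along with the fact that it maps cocycles to cocycles, which the next
   extension requires. *)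
pose st n := {f : {linear X n -> Y n} | forall x, dX n x = 0 -> dY n (f x) = 0}.
have [|f0 f0E] := @injective_extend R _ _ _ aug w (Yinj 0%N).
  by move=> x ax; rewrite (aug_inj x 0) ?linear0.
have f0P x : dX 0 x = 0 -> dY 0 (f0 x) = 0.
  by move=> /ex0[y <-]; rewrite f0E.
have step n (s : st n) :
    {s' : st n.+1 | forall x, sval s' (dX n x) = dY n (sval s x)}.
  apply: cid; case: s => f fP /=.
  have fP' x : dX n x = 0 -> (dY n \o f) x = 0 by apply: fP.
  have [g gE] := injective_extend (Yinj n.+1) fP'.
  have gP x : dX n.+1 x = 0 -> dY n.+1 (g x) = 0.
    by move=> /exX[y <-]; rewrite gE complexY.
  by exists (exist _ g gP).
pose F := fix F n : st n :=
  if n is n'.+1 return st n then sval (step n' (F n')) else exist _ f0 f0P.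
exists (fun n => sval (F n)); split=> // n x.
by rewrite /=; case: (step n (F n)).
Qed.

Variable f : forall n, {linear X n -> Y n}.
Hypothesis fd : forall n x, f n.+1 (dX n x) = dY n (f n x).
Hypothesis f_inj : forall x, dX 0 x = 0 -> f 0 x = 0 -> x = 0.
Hypothesis f_surj : forall y, dY 0 y = 0 -> exists x, dX 0 x = 0 /\ f 0 x = y.
Hypothesis flX : forall n, flasque [set: X n].
Hypothesis flY : forall n, flasque [set: Y n].

(** [D0] and [D] are the differentials of the mapping cone of [f]. The hypotheses on [f] make the
    cone exact, its cocycles being the sets [K] below. *)
Let D0 (x : X 0) : X 1 * Y 0 := (dX 0 x, f 0 x).
Let D n (z : X n.+1 * Y n) : X n.+2 * Y n.+1 :=
  (dX n.+1 z.1, f n.+1 z.1 - dY n z.2).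

Fact cone0_linear : linear D0.
Proof. by move=> a x y; rewrite /D0 !linearP. Qed.

Fact cone_linear n : linear (@D n).
Proof.
move=> a [x y] [x' y']; rewrite /D /= !linearP; congr pair => /=.
by rewrite scalerDr addrACA.
Qed.

Let K n : set (X n.+1 * Y n) :=
  [set z | dX n.+1 z.1 = 0 /\ f n.+1 z.1 = dY n z.2].

Lemma range_cone0 : range (mklin cone0_linear) = @K 0%N.
Proof.
apply/seteqP; split=> [_ [x _ <-]|[x y] [/= dx fx]].
  by split; rewrite /= ?complexX ?fd.
have /exX[x' xE] := dx.
have [|t [dt ft]] := f_surj (y := y - f 0 x').
  by rewrite linearB -fd xE fx subrr.
exists (x' + t) => //=; rewrite /D0 !linearD dt ft xE addr0.
by rewrite addrC subrK.
Qed.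

Lemma range_cone n : range (mklin (@cone_linear n)) = @K n.+1.
Proof.
apply/seteqP; split=> [_ [[x y] _ <-]|[x y] [/= dx fx]].
  by split; rewrite /= ?complexX // fd linearB complexY subr0.
have /exX[x' xE] := dx.
have /exY[y' yE] : dY n.+1 (f n.+1 x' - y) = 0.
  by rewrite linearB -fd xE fx subrr.
exists (x', y') => //=; rewrite /D /= xE yE.
by rewrite opprB addrC subrK.
Qed.

Lemma ker_cone0 : [set v | mklin cone0_linear v = 0] = [set 0].
Proof.
apply/seteqP; split=> [x [] /= dx fx|_ ->]; first exact: f_inj.
exact: linear0.
Qed.

Lemma ker_cone n : [set v | mklin (@cone_linear n) v = 0] = @K n.
Proof.
apply/seteqP; split=> [[x y] [/= dx /eqP]|[x y] [/= dx fx]].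
  by rewrite subr_eq0 => /eqP.
by rewrite /= /D /= dx fx subrr.
Qed.

(** Work from the left end of the exact cone: [K 0] is a copy of [X 0], and [K n.+1] is the quotient
    of [X n.+1 * Y n] by [K n]. *)
Lemma flasque_cone n : flasque (@K n).
Proof.
elim: n => [|n IH].
  rewrite -range_cone0; apply: flasque_range => //.
  by rewrite ker_cone0; apply: flasque_set0.
rewrite -range_cone; apply: flasque_range; first exact: flasque_prod.
by rewrite ker_cone.
Qed.

(** The pair (0, z) is a torsion cocycle of the cone, hence the image of a torsion element (x, y);
    this says d x = 0 and f x - d y = z. In degree 0 the lift is a single x with f x = z. *)
Lemma quasi_iso_tor_surj J n (z : Y n) : tor J z -> dY n z = 0 ->
  exists x, [/\ tor J x, dX n x = 0 & tor_coboundaries dY J (z - f n x)].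
Proof.
move=> Tz dz.
have Kz : @K n (0, z) by split; rewrite /= ?linear0 ?dz.
have T0z : tor J ((0, z) : X n.+1 * Y n).
  by move=> y /Tz[k kE]; exists k; congr pair => //=; rewrite scaler0.
case: n z Tz dz Kz T0z => [|n] z Tz dz.
  rewrite -range_cone0 => Rz T0z.
  have fK : flasque [set v | mklin cone0_linear v = 0].
    by rewrite ker_cone0; apply: flasque_set0.
  have [x Tx [dx fx]] := flasque_tor_lift fK Rz T0z.
  by exists x; split=> //=; rewrite fx subrr.
rewrite -range_cone => Rz T0z.
have fK : flasque [set v | mklin (@cone_linear n) v = 0].
  by rewrite ker_cone; apply: flasque_cone.
have [x Tx [dx fx]] := flasque_tor_lift fK Rz T0z.
exists x.1; split=> //; first exact: (@tor_linear _ _ _ fst).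
exists (- x.2); last by rewrite linearN -fx addrAC subrr add0r.
by apply: (submoduleN (submodule_tor _ _)); apply: (@tor_linear _ _ _ snd).
Qed.

End Complexes.

(** * Counting steps of a composition series *)

Section Local.
Variables (R : comNzRingType) (m : set R).
Hypotheses (noeth : noetherian R) (loc : local_ring m).

Lemma local_ideal : ideal m. Proof. by case: loc => -[]. Qed.

Lemma local_unit x : ~ m x -> exists y, x * y = 1.
Proof.
move=> nmx; apply: contrapT => nx.
pose F := [set J : set R | [/\ ideal J, J x & ~ J 1]].
have Fid J : F J -> ideal J by case.
have F0 : F !=set0.
  exists [set r | exists y, r = x * y]; split.
  - split; first by exists 0; rewrite mulr0.
    move=> a _ _ [y ->] [z ->]; exists (a * y + z).
    by rewrite mulrDr mulrCA.
  - by exists 1; rewrite mulr1.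
  - by move=> [y xy]; apply: nx; exists y.
have [J [[idJ Jx J1] Jmax]] := noetherian_maximal noeth Fid F0.
apply: nmx; have <- : J = m; last by [].
apply: loc.2; split=> // J' idJ' J'1 JJ'; apply/seteqP; split=> //.
by apply: Jmax => //; split=> //; apply: JJ'.
Qed.

Lemma local_unit1B x : m x -> exists y, (1 - x) * y = 1.
Proof.
move=> mx; apply: local_unit => m1x; case: loc.1 => _ + _; apply.
by rewrite -[1](subrK x); apply: (submoduleD local_ideal).
Qed.

Lemma simple_step_generated (V : lmodType R) (A B : set V) (x y : V) :
  submodule A -> submodule B -> simple_step A B -> B x -> B y -> ~ A y ->
  exists r, A (x - r *: y).
Proof.
move=> sA sB [AB _ ABs] Bx By nAy.
pose C := [set v | exists a r, A a /\ v = a + r *: y].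
have sC : submodule C.
  split; first by exists 0, 0; rewrite scale0r addr0; split=> //; case: sA.
  move=> c _ _ [a [r [Aa ->]]] [b [s [Ab ->]]].
  exists (c *: a + b), (c * r + s); split; first by apply: sA.2.
  by rewrite scalerDr scalerDl scalerA addrACA.
have AC : A `<=` C by move=> a Aa; exists a, 0; rewrite scale0r addr0.
have CB : C `<=` B.
  move=> _ [a [r [Aa ->]]]; apply: (submoduleD sB); first exact: AB.
  exact: submoduleZ.
have [CA|CE] := ABs C sC AC CB.
  case: nAy; rewrite -CA; exists 0, 1; rewrite add0r scale1r; split=> //.
  by case: sA.
have : C x by rewrite CE.
by move=> [a [r [Aa ->]]]; exists r; rewrite addrK.
Qed.

(** If r y were outside A, it would generate B modulo A, so (1 - s r) y would be in A for some s,
    with 1 - s r a unit. *)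
Lemma simple_step_killed (V : lmodType R) (A B : set V) (r : R) (y : V) :
  submodule A -> submodule B -> simple_step A B -> B y -> m r -> A (r *: y).
Proof.
move=> sA sB sAB By mr; apply: contrapT => nAry.
have [s] := simple_step_generated sA sB sAB By (submoduleZ sB r By) nAry.
rewrite scalerA -[X in X - _]scale1r -scalerBl => As.
have [t tE] := local_unit1B (@submoduleZ R R^o m local_ideal s r mr).
apply: nAry; rewrite -[y]scale1r -tE mulrC -scalerA.
by do 2!apply: (submoduleZ sA).
Qed.

(** * Length over the subring Lambda *)

Section Counting.
Variables (p q : nat) (u : 'I_q -> R).

(** Submodules over the ring generated by the p-th powers and the [u i], which is Lambda once
    products of the [u i] are combinations of them. *)
Definition stable (V : lmodType R) (D : set V) : Prop :=
  [/\ D 0, forall x y, D x -> D y -> D (x - y),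
      forall r x, D x -> D (r ^+ p *: x) &
      forall i x, D x -> D (u i *: x)].

Lemma submodule_stable (V : lmodType R) (D : set V) : submodule D -> stable D.
Proof.
move=> sD; split; first exact: submodule0.
- by move=> x y; apply: submoduleB.
- by move=> r x; apply: submoduleZ.
- by move=> i x; apply: submoduleZ.
Qed.

Lemma stableD (V : lmodType R) (D : set V) x y :
  stable D -> D x -> D y -> D (x + y).
Proof.
move=> [D0 DB _ _] Dx Dy; rewrite -[y]opprK -[- y]sub0r.
by apply: (DB) => //; apply: DB.
Qed.

Lemma stable_comb (V : lmodType R) (D : set V) (a : 'I_q -> R) (y : V) :
  stable D -> D y -> D ((\sum_(i < q) a i ^+ p * u i) *: y).
Proof.
move=> sD Dy; case: (sD) => D0 DB Dp Du; rewrite scaler_suml.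
elim/big_ind: _ => // [v w|i _]; first exact: stableD.
by rewrite -scalerA; apply: (Dp); apply: Du.
Qed.

Hypothesis u_gen : forall r, exists a : 'I_q -> R,
  m (r - \sum_(i < q) a i ^+ p * u i).

Variables (V : lmodType R) (l : nat) (C : nat -> set V).
Hypothesis Csub : forall j, (j <= l)%N -> submodule (C j).
Hypothesis Csimple : forall j, (j < l)%N -> simple_step (C j) (C j.+1).

(** The number of jumps stands for the length of D over Lambda, relative to [C 0]. *)
Definition jumps (D : set V) : pred 'I_l :=
  [pred j : 'I_l | `[< exists x, [/\ D x, C j.+1 x & ~ C j x] >]].

Lemma jumps_subset (D D' : set V) : D `<=` D' -> jumps D \subset jumps D'.
Proof.
move=> DD'; apply/fintype.subsetP => j /asboolP[x [Dx Cx nCx]].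
by apply/asboolP; exists x; split=> //; apply: DD'.
Qed.

(** The factors of the series are killed by m, so they remain simple over Lambda since Lambda + m =
    R. At a common jump an element of D' can therefore be moved into the previous [C j] by
    subtracting a Lambda-multiple of an element of D. *)
Lemma jumps_card_eq (D D' : set V) : stable D -> stable D' ->
  D `<=` D' -> C 0%N `<=` D -> D' `<=` C l ->
  (#|jumps D'| <= #|jumps D|)%N -> D' `<=` D.
Proof.
move=> sD sD' DD' CD D'C cardD.
have jE : jumps D =i jumps D'.
  by apply/subset_cardP; [apply/eqP; rewrite eqn_leq cardD subset_leq_card
    ?jumps_subset|apply: jumps_subset].
suff H j : (j <= l)%N -> forall x, D' x -> C j x -> D x.
  by move=> x D'x; apply: (H l) => //; apply: D'C.
elim: j => [|j IH] jl x D'x Cx; first exact: CD.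
have [Cjx|nCjx] := pselect (C j x); first by apply: IH => //; apply: ltnW.
have : Ordinal jl \in jumps D' by apply/asboolP; exists x.
rewrite -jE => /asboolP[y [Dy Cy nCy]].
have [sC sC'] := (Csub (ltnW jl), Csub jl).
have [r Cr] := simple_step_generated sC sC' (Csimple jl) Cx Cy nCy.
have [a ma] := u_gen r.
have Day := stable_comb a sD Dy.
rewrite -[x](subrK ((\sum_i a i ^+ p * u i) *: y)).
apply: (stableD sD) => //; apply: IH; first exact: ltnW.
  by case: (sD') => _ DB' _ _; apply: DB' => //; apply: DD'.
have -> : x - (\sum_i a i ^+ p * u i) *: y =
    (x - r *: y) + (r - \sum_i a i ^+ p * u i) *: y.
  by rewrite scalerBl addrA subrK.
apply: (submoduleD sC) => //.
exact: simple_step_killed sC sC' (Csimple jl) Cy ma.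
Qed.

Hypothesis u_mul : forall i j, exists a : 'I_q -> R,
  u i * u j = \sum_(k < q) a k ^+ p * u k.
Variable g : V -> V.
Hypotheses (gB : forall x y, g (x - y) = g x - g y)
  (gp : forall r x, g (r ^+ p *: x) = r *: g x)
  (g0 : forall x, C 0%N x -> C 0%N (g x)).
Hypothesis g_surj : forall v : V, C l v ->
  exists2 z, C l z & forall i, C 0%N (g (u i *: z) - v).

Let T j : set V := [set z | C l z /\ forall i, C j (g (u i *: z))].

(* The T j are l + 1 stable subgroups between C 0 and C l, each of them
   strictly larger than the previous one, so that T 0 has no jump. *)
Lemma stable_injective z : C l z -> (forall i, C 0%N (g (u i *: z))) -> C 0%N z.
Proof.
have C_le j k : (j <= k <= l)%N -> C j `<=` C k.
  move=> /andP[jk kl]; rewrite -(subnKC jk) in kl *.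
  elim: (k - j)%N kl => [|d IH]; first by rewrite addn0 => _ x.
  rewrite addnS => dl; apply: subset_trans (IH (ltnW dl)) _.
  by case: (Csimple dl).
have g00 : g 0 = 0 by rewrite -{1}(subrr 0) gB subrr.
have gD x y : g (x + y) = g x + g y.
  by rewrite -{1}[y]opprK -[- y]sub0r !gB g00 sub0r opprK.
have g_sum (I : Type) (r : seq I) (F : I -> V) :
  g (\sum_(i <- r) F i) = \sum_(i <- r) g (F i) by apply: (big_morph g gD g00).
have sT j : (j <= l)%N -> stable (T j).
  move=> jl; have [sC sCl] := (Csub jl, Csub (leqnn l)); split.
  - by split=> [|i]; rewrite ?scaler0 ?g00; apply: submodule0.
  - move=> x y [Cx Tx] [Cy Ty]; split; first exact: submoduleB.
    by move=> i; rewrite scalerBr gB; apply: submoduleB.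
  - move=> r x [Cx Tx]; split; first exact: submoduleZ.
    by move=> i; rewrite scalerA mulrC -scalerA gp; apply: submoduleZ.
  - move=> k x [Cx Tx]; split; first exact: submoduleZ.
    move=> i; have [a aE] := u_mul i k.
    rewrite scalerA aE scaler_suml g_sum; apply: (submodule_sum sC) => t _.
    by rewrite -scalerA gp; apply: submoduleZ.
have C0T j : (j <= l)%N -> C 0%N `<=` T j.
  move=> jl x C0x; split; first by apply: (C_le 0%N) => //; rewrite leqnn.
  move=> i; apply: (C_le 0%N) => //; apply: g0; apply: submoduleZ => //.
  exact: Csub.
(* An index exists: for q = 0, [u_gen] would put 1 in m. *)
have [i0 _|q0] := pickP (predT : pred 'I_q); last first.
  have [a] := u_gen 1; rewrite big_pred0 ?subr0; last by move=> i; have := q0 i.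
  by case: loc.1.
(* For v in [C j.+1], some x has every g (u_i x) congruent to v modulo [C 0], so x is in [T j.+1];
   were it always in [T j], then [C j.+1] would equal [C j]. *)
have Tlt j : (j < l)%N -> (#|jumps (T j)| < #|jumps (T j.+1)|)%N.
  move=> jl; rewrite ltnNge; apply/negP => card_le.
  have TT : T j `<=` T j.+1.
    move=> x [Cx Tx]; split=> // i; apply: (C_le j); last exact: Tx.
    by rewrite leqnSn.
  have TC : T j.+1 `<=` C l by move=> x [].
  have TT' := jumps_card_eq (sT j (ltnW jl)) (sT _ jl) TT (C0T j (ltnW jl)) TC card_le.
  case: (Csimple jl) => CC nCC _; apply: nCC; apply/seteqP; split=> // v Cv.
  have [|x Cx xv] := @g_surj v; first by apply: (C_le j.+1) => //; rewrite jl leqnn.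
  have sCj := Csub (ltnW jl).
  have C0j : C 0%N `<=` C j by apply: C_le; apply: ltnW.
  have /TT'[_ /(_ i0)] : T j.+1 x.
    split=> // i; rewrite -(subrK v (g _)); apply: (submoduleD (Csub jl)) => //.
    by apply: CC; apply: C0j.
  move=> Cg; rewrite -[v](subKr (g (u i0 *: x))).
  by apply: (submoduleB sCj) => //; apply: C0j.
have Tge j : (j <= l)%N -> (j + #|jumps (T 0%N)| <= #|jumps (T j)|)%N.
  elim: j => // j IH jl; apply: leq_ltn_trans (Tlt j jl).
  by apply: IH; apply: ltnW.
have T0 : (#|jumps (T 0%N)| <= #|jumps (C 0%N)|)%N.
  suff -> : #|jumps (T 0%N)| = 0%N by [].
  (* There are only l possible jumps, and [T l] has at least l more of them than [T 0]. *)
  have := leq_trans (Tge l (leqnn l)) (max_card _).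
  by rewrite card_ord -[X in (_ <= X)%N]addn0 leq_add2l leqn0 => /eqP.
move=> Cz Tz.
apply: (jumps_card_eq _ (sT _ (leq0n l)) (C0T _ (leq0n l)) _ _ T0) => //.
- exact/submodule_stable/Csub.
- by move=> x [].
Qed.

End Counting.
End Local.

(** * Local cohomology of summands of F_*(R) *)

Definition frob_mod (R : comNzRingType) (p : nat) (hp : p \in [pchar R])
  (V : lmodType R) : Type := V.

Section FrobeniusModules.
Variables (R : comNzRingType) (p : nat) (hp : p \in [pchar R]) (V : lmodType R).

HB.instance Definition _ := GRing.Zmodule.on (frob_mod hp V).

Definition frob_mod_scale (r : R) (a : frob_mod hp V) : frob_mod hp V :=
  r ^+ p *: (a : V).

Fact frob_mod_scaleA a b v :
  frob_mod_scale a (frob_mod_scale b v) = frob_mod_scale (a * b) v.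
Proof. by rewrite /frob_mod_scale exprMn scalerA. Qed.
Fact frob_mod_scale1 : left_id 1 frob_mod_scale.
Proof. by move=> v; rewrite /frob_mod_scale expr1n scale1r. Qed.
Fact frob_mod_scaleDr : right_distributive frob_mod_scale +%R.
Proof. by move=> a u v; rewrite /frob_mod_scale scalerDr. Qed.
Fact frob_mod_scaleDl v : {morph frob_mod_scale^~ v : a b / a + b}.
Proof.
by move=> a b; rewrite /frob_mod_scale -!(pFrobenius_autE hp) rmorphD scalerDl.
Qed.

HB.instance Definition _ := GRing.Zmodule_isLmodule.Build R (frob_mod hp V)
  frob_mod_scaleA frob_mod_scale1 frob_mod_scaleDr frob_mod_scaleDl.

Lemma frob_mod_scaleE (r : R) (a : frob_mod hp V) :
  r *: a = (r ^+ p *: (a : V) : V).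
Proof. by []. Qed.

Lemma tor_frob_mod J (x : V) : tor J (x : frob_mod hp V) <-> tor J x.
Proof.
have p_gt0 : (0 < p)%N by rewrite prime_gt0 ?(pcharf_prime hp).
split=> T y /T[n nE].
  by exists (n * p)%N; rewrite exprM.
exists n; rewrite frob_mod_scaleE -exprM.
by apply: scale_exp_le nE; rewrite leq_pmulr.
Qed.

(** Since x acts on F_*(V) as x^p does on V, this is division by x^p in V. *)
Lemma flasque_frob_mod : flasque [set: V] -> flasque [set: frob_mod hp V].
Proof.
move=> fV J x e _ /tor_frob_mod Te.
have [e' [N [_ Te' E]]] := flasque_iter p x fV I Te.
exists e', N; split=> //; first exact/tor_frob_mod.
rewrite !frob_mod_scaleE -exprM; apply: scale_exp_le E.
by rewrite leq_pmulr // prime_gt0 ?(pcharf_prime hp).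
Qed.

End FrobeniusModules.

(** * Splitting a free module off F_*(R) *)

Section Core.
Variables (R : comNzRingType) (m : set R) (p : nat) (hp : p \in [pchar R]).
Hypotheses (noeth : noetherian R) (loc : local_ring m).
Variables (M : lmodType R) (j : {linear M -> frob_push hp}).
Variables (q : nat) (u : 'I_q -> R) (phi : {linear frob_push hp -> R^o}).

(** The ring multiplication on F_*(R), as opposed to the scalar action through r^p; it commutes with
    that action. *)
Definition pmul (r : R) (x : frob_push hp) : frob_push hp := r * (x : R).

Definition gram : 'M[R]_q := \matrix_(i, k) (phi (u i * u k : R) : R).

Hypothesis gram_inv : exists B : 'M[R]_q, B *m gram = 1%:M.
Hypothesis j_inj : injective j.
Hypothesis j_range : forall x,
  (exists y, j y = x) <-> forall i, phi (pmul (u i) x) = 0.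

Let comb (c : 'I_q -> R) : frob_push hp := \sum_(k < q) c k *: (u k : frob_push hp).

Lemma combE c : comb c = \sum_(k < q) c k ^+ p * u k.
Proof. by []. Qed.

Lemma phi_comb c i : phi (pmul (u i) (comb c)) = \sum_(k < q) c k * gram i k.
Proof.
have -> : pmul (u i) (comb c) =
    \sum_(k < q) c k *: (u i * u k : frob_push hp).
  rewrite /pmul /comb mulr_sumr; apply: eq_bigr => k _.
  exact: (mulrCA (u i) (c k ^+ p) (u k)).
by rewrite linear_sum; apply: eq_bigr => k _; rewrite linearZ /= mxE.
Qed.

Lemma comb_solve (c : 'I_q -> R) :
  exists b, forall i, phi (pmul (u i) (comb b)) = c i.
Proof.
have [B BG] := gram_inv; have GB := mulmx1C BG.
exists (fun k => \sum_i B k i * c i) => i; rewrite phi_comb.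
have /matrixP/(_ i 0) := mul1mx (\col_i c i).
rewrite -GB -mulmxA !mxE => <-; apply: eq_bigr => k _.
rewrite mulrC !mxE; congr (_ * _); apply: eq_bigr => t _.
by rewrite mxE.
Qed.

Lemma comb_inj c : (forall i, phi (pmul (u i) (comb c)) = 0) -> comb c = 0.
Proof.
move=> c0; have [B BG] := gram_inv.
have cE : \col_k c k = 0.
  rewrite -[LHS]mul1mx -BG -mulmxA (_ : _ *m \col_k c k = 0) ?mulmx0 //.
  apply/matrixP => i k; rewrite !mxE -[RHS](c0 i) phi_comb.
  by apply: eq_bigr => t _; rewrite [X in _ * X]mxE mulrC.
rewrite /comb big1 // => k _; have /matrixP/(_ k 0) := cE.
by rewrite !mxE => ->; rewrite scale0r.
Qed.

Lemma pmulD r x y : pmul r (x + y) = pmul r x + pmul r y.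
Proof. exact: mulrDr. Qed.

Lemma pmulB r x y : pmul r (x - y) = pmul r x - pmul r y.
Proof. exact: mulrBr. Qed.

Lemma pmulZ r a x : pmul r (a *: x) = a *: pmul r x.
Proof. exact: mulrCA. Qed.

Lemma j_phi y i : phi (pmul (u i) (j y)) = 0.
Proof. by move: i; apply/j_range; exists y. Qed.

Lemma combZD a c d : comb (fun k => a * c k + d k) = a *: comb c + comb d.
Proof.
rewrite /comb scaler_sumr -big_split /=; apply: eq_bigr => k _.
by rewrite scalerDl scalerA.
Qed.

(** Solving the Gram system gives b such that x - comb b is killed by all phi (u_i _), hence lies in
    the image of [j]. The two conclusions say that x |-> ((phi (u_i x))_i, pr x) is a bijection onto
    R^q x M. *)
Lemma split_projection : exists pr : {linear frob_push hp -> M},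
  (forall x, (forall i, phi (pmul (u i) x) = 0) -> pr x = 0 -> x = 0) /\
  (forall (c : 'I_q -> R) y, exists x,
     (forall i, phi (pmul (u i) x) = c i) /\ pr x = y).
Proof.
have dec x : exists y, exists c, x = comb c + j y.
  have [b bE] := comb_solve (fun i => phi (pmul (u i) x)).
  have /j_range[y yE] : forall i, phi (pmul (u i) (x - comb b)) = 0.
    by move=> i; rewrite pmulB linearB /= bE subrr.
  by exists y, b; rewrite yE addrC subrK.
have [s sE] := choice dec.
have sI c y x : x = comb c + j y -> s x = y.
  move=> xE; have [d dE] := sE x.
  pose e k := (-1) * d k + c k.
  have eE : comb e = j (s x) - j y.
    have cE : comb c = comb d + (j (s x) - j y) by rewrite addrA -dE xE addrK.
    by rewrite combZD scaleN1r cE addKr.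
  have e0 : comb e = 0.
    by apply: comb_inj => i; rewrite eE pmulB linearB /= !j_phi subrr.
  by apply: j_inj; apply/eqP; rewrite -subr_eq0 -eE e0.
have slin : linear s.
  move=> a x y; have [[c cE] [d dE]] := (sE x, sE y).
  apply: (sI (fun k => a * c k + d k)).
  by rewrite combZD linearP {1}cE {1}dE scalerDr addrACA.
exists (mklin slin); split=> [x x0 /= sx|c y].
  have [c cE] := sE x; move: cE; rewrite sx linear0 addr0 => cE.
  by rewrite cE; apply: comb_inj => i; rewrite -cE.
have [b bE] := comb_solve c.
exists (comb b + j y); split=> [i|]; last exact: sI.
by rewrite pmulD linearD /= bE j_phi addr0.
Qed.

Lemma summand_fg : F_finite hp -> fg_module M.
Proof.
move=> [n [v vE]]; have [pr [_ pr_surj]] := split_projection.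
exists n, (pr \o v); apply/seteqP; split=> // y _.
have [x [_ <-]] := pr_surj (fun=> 0) y.
have : Defs.span v x by rewrite vE.
move=> [c ->]; exists c; rewrite linear_sum; apply: eq_bigr => i _.
by rewrite linearZ.
Qed.

(** Together with [frobenius_generated_field], this shows that M is nonzero when R is not a
    field. *)
Lemma summand_zero : (forall y : M, y = 0) ->
  forall x : R, exists a : 'I_q -> R, x = \sum_(k < q) a k ^+ p * u k.
Proof.
move=> M0 x; have [b bE] := comb_solve (fun i => phi (pmul (u i) x)).
have [pr [pr_inj _]] := split_projection.
exists b; rewrite -combE; apply/eqP; rewrite -subr_eq0; apply/eqP.
apply: pr_inj => // i.
by rewrite (pmulB (u i) x) linearB /= bE subrr.
Qed.

Hypothesis u_gen : forall r, exists a : 'I_q -> R,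
  m (r - \sum_(k < q) a k ^+ p * u k).
Hypothesis u_mul : forall i l, exists a : 'I_q -> R,
  u i * u l = \sum_(k < q) a k ^+ p * u k.

Lemma lc_coboundariesE J (N : lmodType R) (I : injective_resolution N) n :
  (forall V : lmodType R, @torsion R m V = @tor R V J) ->
  @lc_coboundaries R m N I n = tor_coboundaries (@res_diff R N I) J (n := n).
Proof. by move=> torE; case: n => [|n] //=; rewrite torE. Qed.

(** The splitting lifts to a map from F_*(Q) to Q^q x I. A torsion cocycle w of I, seen as (0, w),
    comes up to coboundaries from a torsion cocycle z of Q; [stable_injective] makes z a coboundary,
    hence w too. *)
Lemma summand_lc_vanishes n : lc_finite_length m n R^o -> lc_vanishes m n M.
Proof.
move=> fl I.
have [Q] := injective_resolution_exists hp R^o.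
have [l [C [C0 Cl Csub Csimple]]] := fl Q.
have [s [t mE]] := noeth (local_ideal loc).
pose J := codom t.
have torE V : @torsion R m V = @tor R V J.
  by apply/seteqP; split=> x /(torsionP x noeth (local_ideal loc) mE).
have exI k x : res_diff I k.+1 x = 0 <-> exists y, res_diff I k y = x.
  exact: res_exactS.
have [pr [pr_inj pr_surj]] := split_projection.
pose X k : lmodType R := frob_mod hp (res_obj Q k).
have dXlin k : linear (res_diff Q k : X k -> X k.+1).
  by move=> a x y; exact: (linearP (res_diff Q k) (a ^+ p) x y).
pose dX k := mklin (dXlin k).
have auglin : linear (res_aug Q : frob_push hp -> X 0%N).
  by move=> a x y; exact: (linearP (res_aug Q) (a ^+ p) x y).
pose aug := mklin auglin.
have exX k x : dX k.+1 x = 0 <-> exists y, dX k y = x by apply: res_exactS.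
have ex0 x : dX 0 x = 0 <-> exists y, aug y = x by apply: res_exact0.
have aug_inj : injective aug by apply: res_aug_inj.
(* [X] is F_*(Q), an exact but not necessarily injective resolution of F_*(R); injectivity of the
   target suffices for lifting. *)
have lift (N : lmodType R) (K : injective_resolution N)
    (v : {linear frob_push hp -> N}) :
    exists f : forall k, {linear X k -> res_obj K k},
      (forall x, f 0%N (aug x) = res_aug K (v x)) /\
      forall k x, f k.+1 (dX k x) = res_diff K k (f k x).
  have [] := @chain_map_exists _ _ _ dX (@res_diff _ _ K) exX
    (@res_exactS _ _ K) _ aug (res_aug K \o v) (@res_injective _ _ K)
    aug_inj ex0.
    by move=> x /=; apply/res_exact0; exists (v x).
  by move=> f [f0 fd]; exists f.
have [g [g0 gd]] := lift _ Q phi.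
have [h [h0 hd]] := lift _ I pr.
pose Y k : lmodType R := (('I_q -> res_obj Q k) * res_obj I k)%type.
pose dYf k (z : Y k) : Y k.+1 :=
  (fun i => res_diff Q k (z.1 i), res_diff I k z.2).
have dYlin k : linear (@dYf k).
  move=> a [x y] [x' y']; congr pair; last exact: linearP.
  by apply: funext => i; apply: linearP.
pose dY k := mklin (dYlin k).
have exY k x : dY k.+1 x = 0 <-> exists y, dY k y = x.
  case: x => a b; split=> [[/= dx /res_exactS[b' bE]]|[[a' b'] [<- <-]]].
    have /choice[a' aE] i : exists y, res_diff Q k y = a i.
      by apply/res_exactS; have := congr1 (fun v => v i) dx.
    by exists (a', b'); congr pair => //; apply: funext.
  congr pair; last by apply/res_exactS; exists b'.
  by apply: funext => i; apply/res_exactS; exists (a' i).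
(* Multiplication by [u i] is linear on [X k], so component i lifts x |-> phi (u_i x). *)
pose ff k (z : X k) : Y k :=
  (fun i => g k (u i *: (z : res_obj Q k) : X k), h k z).
have flin k : linear (@ff k).
  move=> a x y; congr pair; last exact: linearP.
  apply: funext => i; rewrite -[RHS]linearP; congr (g k _).
  by rewrite scalerDr !frob_mod_scaleE !scalerA mulrC.
pose f k := mklin (flin k).
have fd k x : f k.+1 (dX k x) = dY k (f k x).
  congr pair; last exact: hd.
  apply: funext => i; rewrite -[RHS]gd; congr (g _ _).
  by rewrite /= linearZ.
have f_inj x : dX 0 x = 0 -> f 0%N x = 0 -> x = 0.
  move=> /ex0[y <-] [/= gy hy].
  suff -> : y = 0 by apply: linear0.
  apply: pr_inj => [i|].
    apply: (@res_aug_inj _ _ Q); rewrite [RHS]linear0 -[LHS]g0.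
    have augM : aug (pmul (u i) y) = (u i *: (aug y : res_obj Q 0%N) : X 0%N).
      exact: (linearZZ (res_aug Q) (u i) (y : R^o)).
    by rewrite augM; have := congr1 (fun v => v i) gy.
  by apply: (@res_aug_inj _ _ I); rewrite [RHS]linear0 -[LHS]h0.
have f_surj y : dY 0 y = 0 -> exists x, dX 0 x = 0 /\ f 0%N x = y.
  case: y => a b [/= da /res_exact0[b' bE]].
  have /choice[a' aE] i : exists c, res_aug Q c = a i.
    by apply/res_exact0; have := congr1 (fun v => v i) da.
  have [x [xa xb]] := pr_surj a' b'.
  exists (aug x); split; first by apply/ex0; exists x.
  congr pair; last by rewrite h0 xb.
  apply: funext => i.
  have augM : (u i *: (aug x : res_obj Q 0%N) : X 0%N) = aug (pmul (u i) x).
    exact/esym/(linearZZ (res_aug Q) (u i) (x : R^o)).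
  by rewrite augM g0 xa.
have flX k : flasque [set: X k].
  by apply/flasque_frob_mod/injective_flasque => //; apply: res_injective.
have flY k : flasque [set: Y k].
  apply: flasque_prod; first apply: flasque_fun.
    by apply: injective_flasque => //; apply: res_injective.
  by apply: injective_flasque => //; apply: res_injective.
have qi := quasi_iso_tor_surj exX exY fd f_inj f_surj flX flY (J := J).
have cobX k (x : X k) : tor_coboundaries (@res_diff _ _ Q) J x ->
    tor_coboundaries dX J x.
  case: k x => [//|k] _ [y Ty <-]; exists y => //; exact/tor_frob_mod.
have cobQ k (a : 'I_q -> res_obj Q k) b i :
    tor_coboundaries dY J ((a, b) : Y k) ->
    tor_coboundaries (@res_diff _ _ Q) J (a i).
  case: k a b => [a b [->] //|k a b [[a' b'] T [<- _]]] /=; exists (a' i) => //.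
  by move=> y /T[e [E _]]; exists e; have := congr1 (fun v => v i) E.
have cobI k (a : 'I_q -> res_obj Q k) b :
    tor_coboundaries dY J ((a, b) : Y k) ->
    tor_coboundaries (@res_diff _ _ I) J b.
  case: k a b => [a b [_ ->] //|k a b [[a' b'] T [_ <-]]] /=; exists b' => //.
  by move=> y /T[e [_ E]]; exists e.
have cobQE := @lc_coboundariesE J R^o Q n torE.
have cobIE := @lc_coboundariesE J M I n torE.
have inj := @stable_injective R m noeth loc p q u u_gen (res_obj Q n) l C Csub
  Csimple u_mul (g n).
apply/seteqP; split=> w; last first.
  rewrite cobIE => cw; have [Tw dw] := tor_coboundaries_sub exI cw.
  by split; rewrite ?torE.
move=> [Tw dw]; rewrite cobIE; rewrite torE in Tw.
have Tfun (v : res_obj Q n) b : tor J v -> tor J b ->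
    tor J (((fun=> v), b) : Y n).
  move=> Tv Tb y yJ; have [[c cE] [d dE]] := (Tv y yJ, Tb y yJ).
  exists (maxn c d); congr pair; last exact: scale_exp_le (leq_maxr _ _) dE.
  by apply: funext => i; apply: scale_exp_le (leq_maxl _ _) cE.
have T0 (V : lmodType R) : tor J (0 : V).
  exact: (submodule0 (submodule_tor V J)).
have [|z [/tor_frob_mod Tz dz fz]] := qi n ((fun=> 0), w) (Tfun 0 w (T0 _) Tw).
  by congr pair => //; apply: funext => i; apply: linear0.
(* Here [C 0] and [C l] are the torsion coboundaries and cocycles of Q. Modulo coboundaries f z is
   (0, w), so each g (u_i z) is a coboundary. *)
have zB : C 0%N z.
  apply: inj.
  - by move=> x y; apply: linearB.
  - by move=> r x; exact: (linearZZ (g n) r x).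
  - rewrite C0 cobQE => x /cobX; exact: tor_coboundaries_map.
  - rewrite Cl C0 cobQE => v [Tv dv]; rewrite torE in Tv.
    (* Surjectivity is obtained from the family with all q components equal to v and zero component
       in I. *)
    have [|x [/tor_frob_mod Tx dx fx]] := qi n ((fun=> v), 0) (Tfun v 0 Tv (T0 _)).
      congr pair; last exact: linear0.
      by apply: funext => i.
    exists x; first by split; rewrite ?torE.
    move=> i; rewrite -opprB.
    have := cobQ _ _ _ i fx; rewrite -cobQE -C0; apply: submoduleN.
    exact: Csub.
  - by rewrite Cl; split; rewrite ?torE.
  - move=> i; have := cobQ _ _ _ i fz; rewrite -cobQE -C0 => B.
    by rewrite -[g n _]opprK -[- g n _]sub0r; apply: (submoduleN (Csub _ (leq0n l))).
have hz : tor_coboundaries (@res_diff _ _ I) J (h n z).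
  by apply: (tor_coboundaries_map hd); apply: cobX; rewrite -cobQE -C0.
rewrite -[w](subrK (h n z)).
have sB := submodule_tor_coboundaries (res_diff I) J n.
by apply: (submoduleD sB) => //; apply: cobI fz.
Qed.

End Core.

(** * Residue fields *)

Section Residue.
Variables (R : comNzRingType) (m : set R) (p : nat) (hp : p \in [pchar R]).
Variables (k : fieldType) (pi : {rmorphism R -> k}).
Hypotheses (noeth : noetherian R) (loc : local_ring m).
Hypothesis res : residue_field m pi.

Lemma residue_unit x : pi x != 0 -> exists y, x * y = 1.
Proof.
by move=> nx; apply: (local_unit noeth loc) => /res.2 /eqP; apply/negP.
Qed.

Lemma residue_unitmx n (A : 'M[R]_n) : \det (map_mx pi A) != 0 ->
  exists B, B *m A = 1%:M.
Proof.
rewrite det_map_mx => /residue_unit[e eE]; exists (e *: \adj A).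
by rewrite -scalemxAl mul_adj_mx scale_scalar_mx mulrC eE.
Qed.

(** Nakayama by determinants: the generators satisfy t = A t with A over m, and 1 - A is invertible
    as it reduces to the identity. *)
Lemma local_nakayama : (forall x, m x -> ideal_mul m m x) ->
  forall x, m x -> x = 0.
Proof.
move=> m2; have idm := local_ideal loc.
have [n [t mE]] := noeth idm.
have mt i : m (t i).
  rewrite mE; exists (fun j => (j == i)%:R).
  rewrite (bigD1 i) //= eqxx scale1r big1 ?addr0 // => j /negPf ->.
  by rewrite scale0r.
have /choice[A AE] i : exists a : 'I_n -> R,
    (forall j, m (a j)) /\ t i = \sum_j a j * t j.
  have [l [a [b [ma mb ->]]]] := m2 _ (mt i).
  have /choice[c cE] s : exists c : 'I_n -> R, b s = \sum_j c j * t j.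
    by have := mb s; rewrite mE => -[c ->]; exists c.
  exists (fun j => \sum_s a s * c s j); split=> [j|].
    apply: (@submodule_sum R R^o m idm) => s _; rewrite mulrC.
    exact: (@submoduleZ R R^o m idm).
  under [RHS]eq_bigr do rewrite mulr_suml.
  rewrite exchange_big /=; apply: eq_bigr => s _.
  rewrite cE mulr_sumr; apply: eq_bigr => j _; exact: mulrA.
pose B : 'M[R]_n := 1%:M - \matrix_(i, j) A i j.
have [|C CB] := @residue_unitmx n B.
  rewrite (_ : map_mx pi B = 1%:M) ?det1 ?oner_eq0 //.
  apply/matrixP => i j; rewrite !mxE rmorphB rmorph_nat.
  by have /res.2 -> := (AE i).1 j; rewrite subr0.
have t0 : \col_i t i = 0.
  rewrite -[LHS]mul1mx -CB -mulmxA (_ : B *m _ = 0) ?mulmx0 //.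
  rewrite mulmxBl mul1mx; apply/matrixP => i j; rewrite !mxE.
  apply/eqP; rewrite subr_eq0 {1}(AE i).2; apply/eqP.
  by apply: eq_bigr => s _; rewrite !mxE.
move=> x; rewrite mE => -[c ->]; rewrite big1 // => i _.
have /matrixP/(_ i 0) := t0; rewrite !mxE => ->; exact: scaler0.
Qed.

Section Nonzero.
Variables (q : nat) (u : 'I_q -> R).
Hypothesis u_indep : forall a : 'I_q -> R,
  m (\sum_(i < q) a i ^+ p * u i) -> forall i, m (a i).

(** By independence an element of m has all its coefficients a_i in m. It then lies in m^2 because p
    is at least 2, so m = m^2 and m = 0. *)
Lemma frobenius_generated_field :
  (forall x, exists a : 'I_q -> R, x = \sum_(i < q) a i ^+ p * u i) ->
  is_field R.
Proof.
move=> gen x x0; apply: (local_unit noeth loc) => mx; apply: x0.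
apply: local_nakayama mx => y my; have [a aE] := gen y.
have ma : forall i, m (a i) by apply: u_indep; rewrite -aE.
have idm := local_ideal loc.
exists q, a, (fun i => a i * (a i ^+ p.-2 * u i)); split=> // [i|].
  by rewrite mulrC; apply: (@submoduleZ R R^o m idm).
rewrite aE; apply: eq_bigr => i _; rewrite !mulrA -expr2 -exprD.
by have := prime_gt1 (pcharf_prime hp); case: (p) => [|[|p']].
Qed.

End Nonzero.

Section SemilinearBasis.
Variable F : fieldType.
Hypothesis hF : p \in [pchar F].

Lemma frobenius_basis n (v : 'I_n -> F) :
  (forall y, exists c : 'I_n -> F, y = \sum_(i < n) c i ^+ p * v i) ->
  exists q (w : 'I_q -> F),
    (forall y, exists c : 'I_q -> F, y = \sum_(i < q) c i ^+ p * w i) /\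
    (forall c : 'I_q -> F, \sum_(i < q) c i ^+ p * w i = 0 -> forall i, c i = 0).
Proof.
elim: n v => [|n IH] v gen; first by exists 0%N, v; split=> // c _ [].
have [ind|] := pselect (forall c : 'I_n.+1 -> F,
  \sum_(i < n.+1) c i ^+ p * v i = 0 -> forall i, c i = 0).
  by exists n.+1, v.
move=> /existsNP[c /not_implyP[c0 /existsNP[i0 /eqP ci0]]].
apply: (IH (fun i => v (lift i0 i))) => y; have [b bE] := gen y.
(* Chosen so that subtracting t^p times the relation cancels the coefficient at [i0]; Frobenius
   being additive, coefficients stay p-th powers. *)
pose t := b i0 / c i0.
have -> : y = \sum_(i < n.+1) (b i - t * c i) ^+ p * v i.
  have -> : y = y - t ^+ p * (\sum_(i < n.+1) c i ^+ p * v i).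
    by rewrite c0 mulr0 subr0.
  rewrite {1}bE mulr_sumr -sumrB; apply: eq_bigr => i _.
  have -> : (b i - t * c i) ^+ p = b i ^+ p - t ^+ p * c i ^+ p.
    by rewrite -exprMn -!(pFrobenius_autE hF) rmorphB.
  by rewrite mulrBl mulrA.
exists (fun i => b (lift i0 i) - t * c (lift i0 i)).
rewrite (bigD1_ord i0) //= /t divfK // subrr expr0n.
have := prime_gt0 (pcharf_prime hF).
by case: (p) => // p' _; rewrite mul0r add0r.
Qed.

End SemilinearBasis.

End Residue.

Section Field.
Variables (R : comNzRingType) (m : set R).

(** A field has no prime chain of positive length, so the cohomological condition is empty. This
    settles the imperfect case when R is a field. *)
Lemma field_maximal_cohen_macaulay :
  is_field R -> maximal_cohen_macaulay m R^o.
Proof.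
move=> fR; split.
- by exists 1; apply/eqP/oner_neq0.
- exists 1%N, (fun=> 1); apply/seteqP; split=> // x _; exists (fun=> x).
  by rewrite big_ord1 -[_ *: _]/(x * 1) mulr1.
- move=> i [l [P [il [Pprime Plt]]]]; exfalso.
  have l0 : (0 < l)%N by apply: leq_ltn_trans il.
  have [[id0 _ _] [id1 P1 _]] := (Pprime 0%N (leq0n l), Pprime 1%N l0).
  have [_] := Plt 0%N l0; apply=> x Px.
  have [->|/eqP/fR[y xy]] := eqVneq x 0; first exact: (submodule0 id0).
  by case: P1; rewrite -xy mulrC; apply: (@submoduleZ R R^o _ id1).
Qed.

End Field.

(** * Maximal Cohen-Macaulay modules *)

Section Cases.
Variables (R : comNzRingType) (m : set R) (p : nat) (hp : p \in [pchar R]).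
Variables (k : fieldType) (pi : {rmorphism R -> k}).
Hypotheses (noeth : noetherian R) (loc : local_ring m).
Hypotheses (res : residue_field m pi) (Ffin : F_finite hp).
Hypothesis gcm : generalized_cohen_macaulay m.

Lemma summand_maximal_cohen_macaulay (M : lmodType R)
    (j : {linear M -> frob_push hp}) (q : nat) (u : 'I_q -> R)
    (phi : {linear frob_push hp -> R^o}) :
  ~ is_field R -> (exists B : 'M[R]_q, B *m gram u phi = 1%:M) ->
  injective j ->
  (forall x, (exists y, j y = x) <-> forall i, phi (pmul (u i) x) = 0) ->
  (forall r, exists a : 'I_q -> R, m (r - \sum_(i < q) a i ^+ p * u i)) ->
  (forall i l, exists a : 'I_q -> R,
     u i * u l = \sum_(i < q) a i ^+ p * u i) ->
  (forall a : 'I_q -> R, m (\sum_(i < q) a i ^+ p * u i) -> forall i, m (a i)) ->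
  maximal_cohen_macaulay m M.
Proof.
move=> nfield inv jinj jrange ugen umul uind; split.
- apply: contrapT => nM; apply: nfield.
  apply: (frobenius_generated_field hp noeth loc res uind).
  apply: (summand_zero inv jinj jrange) => y.
  by apply: contrapT => y0; apply: nM; exists y.
- exact: (summand_fg inv jinj jrange Ffin).
- move=> i /gcm.
  exact: (summand_lc_vanishes noeth loc inv jinj jrange ugen umul).
Qed.

(** Take q = 1, u = 1 and for [phi] the projection of the splitting onto R. Perfection of k says R^p
    + m = R. *)
Lemma complement_maximal_cohen_macaulay (M : lmodType R)
    (j : {linear M -> frob_push hp}) :
  F_splitting j -> perfect_field k -> ~ is_field R ->
  maximal_cohen_macaulay m M.
Proof.
move=> split perf nfield; have [inv inv1 inv2] := split.
have frob0 : frob hp 0 = 0.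
  by rewrite /frob expr0n eqn0Ngt prime_gt0 ?(pcharf_prime hp).
have frobZD a x y : frob hp (a * x + y) = a *: frob hp x + frob hp y.
  rewrite /frob -!(pFrobenius_autE hp) rmorphD rmorphM.
  by rewrite !pFrobenius_autE.
pose s x : R^o := (inv x).1.
have sE r y : s (frob hp r + j y) = r by rewrite /s (inv1 (r, y)).
have slin : linear s.
  move=> a x y; rewrite -{1}(inv2 x) -{1}(inv2 y) scalerDr addrACA.
  by rewrite -linearP -frobZD sE.
pose phi := mklin slin.
have phi1 : phi (1 : R) = 1.
  by have := sE 1 0; rewrite linear0 addr0 /frob expr1n.
apply: (@summand_maximal_cohen_macaulay M j 1 (fun=> 1) phi) => //.
- exists 1%:M; rewrite mul1mx; apply/matrixP => a b.
  by rewrite !mxE !ord1 mul1r phi1 eqxx.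
- move=> x y xy; have := congr1 inv (congr1 (fun t => frob hp 0 + t) xy).
  by rewrite (inv1 (0, x)) (inv1 (0, y)) => -[].
- move=> x; split=> [[y <-] i|/(_ ord0)]; rewrite /pmul mul1r.
    by have := sE 0 y; rewrite frob0 add0r.
  move=> sx; exists (inv x).2; rewrite -[RHS]inv2.
  by have -> : (inv x).1 = 0 by []; rewrite frob0 add0r.
- move=> r; have [b bE] := perf p (rmorph_pchar pi hp) (pi r).
  have [a aE] := res.1 b; exists (fun=> a); apply/res.2.
  by rewrite big_ord1 mulr1 rmorphB rmorphXn /= aE bE subrr.
- by move=> _ _; exists (fun=> 1); rewrite big_ord1 expr1n.
- move=> a; rewrite big_ord1 mulr1 => /res.2 /eqP; rewrite rmorphXn expf_eq0.
  by move=> /andP[_ /eqP /res.2 ma] i; rewrite ord1.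
Qed.

Lemma coefficient_field_maximal_cohen_macaulay (L : set R) :
  F_split hp -> coefficient_field pi L -> ~ is_field R ->
  exists N : lmodType R, maximal_cohen_macaulay m N.
Proof.
move=> [phi phiE] [[L1 LB LM LV] [_ Linj Lsurj]] nfield.
have hk := rmorph_pchar pi hp.
have phi1 : phi (1 : R) = 1 by have := phiE 1; rewrite /frob expr1n.
have L0 : L 0 by rewrite -(subrr 1); apply: LB.
have LD x y : L x -> L y -> L (x + y).
  by move=> Lx Ly; rewrite -[y]opprK -[- y]sub0r; apply: (LB) => //; apply: LB.
have LX x n : L x -> L (x ^+ n).
  by move=> Lx; elim: n => [|n IH]; rewrite ?expr0 // exprS; apply: LM.
have /choice[s sP] y : exists x, L x /\ pi x = y.
  by have [x Lx xy] := Lsurj y I; exists x.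
have Linj' x y : L x -> L y -> pi x = pi y -> x = y.
  by move=> Lx Ly; apply: Linj; rewrite inE.
have [n [v vE]] := Ffin.
(* By F-finiteness, the residues of generators of F_*(R) span k over k^p. *)
have [|q [w [w_gen w_ind]]] := @frobenius_basis p k hk n (fun i => pi (v i)).
  move=> y; have : Defs.span v (s y) by rewrite vE.
  move=> [c cE]; exists (fun i => pi (c i)); rewrite -(sP y).2.
  have -> : s y = \sum_(i < n) c i ^+ p * v i by [].
  by rewrite rmorph_sum; apply: eq_bigr => i _; rewrite rmorphM rmorphXn.
pose u i := s (w i).
have pi_comb (a : 'I_q -> R) :
    pi (\sum_(i < q) a i ^+ p * u i) = \sum_(i < q) pi (a i) ^+ p * w i.
  rewrite rmorph_sum; apply: eq_bigr => i _.
  by rewrite rmorphM rmorphXn /= (sP _).2.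
have L_comb (a : 'I_q -> R) :
    (forall i, L (a i)) -> L (\sum_(i < q) a i ^+ p * u i).
  move=> La; elim/big_ind: _ => // i _; apply: LM; last exact: (sP _).1.
  exact: LX.
have Lgen x : L x -> exists c : 'I_q -> k, x = \sum_(i < q) s (c i) ^+ p * u i.
  move=> Lx; have [c cE] := w_gen (pi x); exists c; apply: Linj' => //.
    by apply: L_comb => i; apply: (sP _).1.
  by rewrite pi_comb cE; apply: eq_bigr => i _; rewrite (sP _).2.
pose K := [set x : frob_push hp | forall i, phi (pmul (u i) x) = 0].
have sK : submodule K.
  split=> [i|a x y Kx Ky i]; first by rewrite /pmul mulr0; apply: linear0.
  by rewrite pmulD pmulZ linearP Kx Ky scaler0 addr0.
exists (subm sK); apply: (@summand_maximal_cohen_macaulay _ (incl sK) q u phi) => //.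
- apply: (residue_unitmx noeth loc res); apply/negP => /det0P[c c0 cG].
  case/negP: c0; apply/eqP/rowP => i; rewrite [RHS]mxE.
  pose a i := s (c 0 i); pose x := \sum_(i < q) a i ^+ p * u i.
  have La l : L (a l) by apply: (sP _).1.
  have x0 : x = 0.
    (* A row c killing the reduced Gram matrix gives x in [L] with phi (x L) inside m. If x were
       nonzero, its inverse y in [L] would give phi (x y) = phi 1 = 1. *)
    apply: contrapT => /(LV _ (L_comb _ La))[y Ly xy].
    have [b bE] := Lgen y Ly.
    have : pi (phi (x * y : R)) = 1.
      by rewrite xy phi1 rmorph1.
    have -> : x * y = \sum_(l < q) a l *: (pmul (u l)
        (\sum_(t < q) s (b t) *: (u t : frob_push hp)) : frob_push hp).
      rewrite /x mulr_suml bE; apply: eq_bigr => l _; exact: esym (mulrA _ _ _).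
    rewrite linear_sum rmorph_sum.
    under eq_bigr => l _.
      rewrite linearZ /= phi_comb -[_ *: _]/(a l * _) mulr_sumr rmorph_sum.
      over.
    rewrite exchange_big big1 /= => [/esym/eqP|t _]; first by rewrite oner_eq0.
    have /rowP/(_ t) := cG; rewrite !mxE => ct.
    transitivity (b t * \sum_l c 0 l * map_mx pi (gram u phi) l t).
      rewrite mulr_sumr; apply: eq_bigr => l _.
      by rewrite !rmorphM /= !(sP _).2 [map_mx _ _ _ _]mxE mulrCA.
    by rewrite ct mulr0.
  have := w_ind (fun i => c 0 i); apply; rewrite -[RHS](rmorph0 pi) -x0 pi_comb.
  by apply: eq_bigr => l _; rewrite (sP _).2.
- move=> x; split=> [[y <-]|]; first exact: (inclP y).
  exact: incl_onto.
- move=> r; have [c cE] := w_gen (pi r); exists (fun i => s (c i)).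
  apply/res.2; rewrite rmorphB /= pi_comb cE; apply/eqP; rewrite subr_eq0.
  by apply/eqP/eq_bigr => i _; rewrite (sP _).2.
- move=> i l; have [c cE] := Lgen (u i * u l) (LM _ _ (sP _).1 (sP _).1).
  by exists (fun t => s (c t)).
- move=> a /res.2; rewrite pi_comb => /w_ind a0 i; exact/res.2.
Qed.

End Cases.

Theorem lemma4p12 (R : comNzRingType) (m : set R) (p : nat)
    (hp : p \in [pchar R]) (k : fieldType) (pi : {rmorphism R -> k})
    (M : lmodType R) (j : {linear M -> frob_push hp}) :
  noetherian R -> local_ring m -> residue_field m pi ->
  F_finite hp -> F_split hp -> generalized_cohen_macaulay m ->
  F_splitting j ->
  (perfect_field k -> ~ is_field R -> maximal_cohen_macaulay m M) /\
  (~ perfect_field k -> (exists L : set R, coefficient_field pi L) ->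
   exists N : lmodType R, maximal_cohen_macaulay m N).
Proof.
move=> noeth loc res Ffin Fsplit gcm split; split=> [|_ [L cL]].
  exact: (complement_maximal_cohen_macaulay noeth loc res Ffin gcm split).
have [fR|nfR] := pselect (is_field R).
  by exists R^o; apply: field_maximal_cohen_macaulay.
exact: (coefficient_field_maximal_cohen_macaulay noeth loc res Ffin gcm Fsplit cL).
Qed.
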